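(* Let $(p_m)_{m\ge1}$ be monic polynomials, $p_m$ of degree $m$ with only nonnegative real roots, and assume the root counting measures $\mu[\![p_m]\!]$ converge weakly to a probability measure $\mu\ne\delta_0$ on $[0,\infty)$. Then $$\nabla^{(m)}\big(\mathcal S^{(m)}_{p_m}\big)(v)\longrightarrow \frac{d}{dv}\big[S_\mu(-v)\big]=-S_\mu'(-v)\qquad(m\to\infty),$$ locally uniformly in $v\in(0,1-\mu(\{0\}))$.
   Context: For a monic $p(x)=\sum_{k=0}^m(-1)^ke_k(p)x^{m-k}$ of degree $m$ with nonnegative roots, $0$ of multiplicity $r$, the finite free $S$ transform is $S^{(m)}_p(-k/m)=\frac{m-k+1}{k}\frac{e_{k-1}(p)}{e_k(p)}$ for $k=1,\dots,m-r$, and its interpolation is $\mathcal S^{(m)}_p(v)=S^{(m)}_p(-\lceil mv\rceil/m)$ for $v\in(0,1-r/m)$. The root counting measure is $\mu[\![p]\!]=\frac1m\sum_{p(z)=0}\delta_z$ (with multiplicity). $\nabla^{(m)}g(v)=m\big(g(v+\tfrac1m)-g(v)\big)$. For a probability measure $\mu\ne\delta_0$ on $[0,\infty)$ with moment transform $\psi_\mu(z)=\int\frac{zx}{1-zx}\mu(dx)$, the free $S$ transform is $S_\mu(z)=\frac{1+z}{z}\psi_\mu^{-1}(z)$ for $z$ near $(-1+\mu(\{0\}),0)$. *)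

(* Defs.v *)
From HB Require Import structures.
From mathcomp Require Import all_boot all_order all_algebra.
From mathcomp Require Import all_classical all_reals all_analysis.
Set Implicit Arguments. Unset Strict Implicit. Unset Printing Implicit Defensive.
Import Order.TTheory GRing.Theory Num.Theory.
Import numFieldNormedType.Exports.
Local Open Scope classical_set_scope.
Local Open Scope ring_scope.

Section FiniteFree.
Variable R : realType.

(* e_k(p): p(x) = sum_{k=0}^m (-1)^k e_k(p) x^(m-k), m = deg p. *)
Definition ecoef (k : nat) (p : {poly R}) : R :=
  if (k <= (size p).-1)%N then (-1) ^+ k * p`_((size p).-1 - k) else 0.

(* Interpolated finite free S transform:
   S_p(v) = S_p(-k/m) = (m-k+1)/k * e_{k-1}(p)/e_k(p), k = ceil(m v), m = deg p.
   (Only meaningful for v in (0, 1 - r/m); junk elsewhere.) *)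
Definition finS (p : {poly R}) (v : R) : R :=
  let m := (size p).-1 in
  let k := `|Num.ceil (m%:R * v)|%N in
  ((m%:R - k%:R + 1) / k%:R) * (ecoef k.-1 p / ecoef k p).

Definition nabla (m : nat) (g : R -> R) (v : R) : R :=
  m%:R * (g (v + m%:R^-1) - g v).

Definition poly_of_roots (rs : seq R) : {poly R} := \prod_(x <- rs) ('X - x%:P).

Definition rcm_integral (rs : seq R) (f : R -> R) : R :=
  (size rs)%:R^-1 * \sum_(x <- rs) f x.

Definition psi (mu : probability R R) (z : R) : R :=
  fine (\int[mu]_x ((z * x) / (1 - z * x))%:E)%E.

(* psi_mu^{-1}(z) on (-1+mu{0},0): the w < 0 with psi_mu(w) = z *)
Definition psi_inv (mu : probability R R) (z : R) : R :=
  xget 0 [set w | w < 0 /\ psi mu w = z].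

Definition freeS (mu : probability R R) (z : R) : R :=
  (1 + z) / z * psi_inv mu z.

End FiniteFree.

(* Main.v *)
Require Import Defs.
From HB Require Import structures.
From mathcomp Require Import all_boot all_order all_algebra.
From mathcomp Require Import all_classical all_reals all_analysis.
From mathcomp Require Import measurable_realfun.
From mathcomp Require Import ring lra zify.
Set Implicit Arguments.
Unset Strict Implicit.
Unset Printing Implicit Defensive.
Import Order.TTheory GRing.Theory Num.Theory.
Import numFieldNormedType.Exports.
Local Open Scope classical_set_scope.
Local Open Scope ring_scope.
(* Write e_k for the elementary symmetric functions of the m roots and
   rho_k = e_(k-1)/e_k, so that S_k = (m-k+1)/k rho_k.  Counting k-subsets through a
   given root shows that the mean F_m(t) of xt/(1+xt) over the roots satisfies
   F_m(rho_k) <= k/m <= F_m(rho_(k+1)), where F_m -> F(t) = -psi_mu(-t); hence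
   rho_k -> T(k/m) with T = F^-1, and S_mu(-v) = (1-v)/v T(v).  This also controls the
   sum of n consecutive steps d_k = rho_(k+1) - rho_k up to one unit out of n, but not
   an individual step.  The missing regularity is total positivity of order three:
   b_k = e_k^2 - e_(k-1)e_(k+1) is log-concave, so the steps d_k = b_k/(e_k e_(k+1))
   are log-concave up to a factor rho_k/rho_(k+2) -> 1.  A positive, almost log-concave
   sequence whose block sums are almost linear is almost constant, so
   m d_k -> T'(k/m) = 1/F'(T). *)

(** The one-unit error in the block sums does not shrink with m. Steps alternating between 1/2 and
    3/2 would pass the block estimates, and positivity of order two only says that steps are
    nonnegative. The error is negligible only against a long block, but the length needed depends on
    the target precision alone. So the argument on almost log-concave sequences is made for a finite
    window of fixed length and tolerance, and m enters later, once it is large enough for the window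
    to meet that tolerance. At each precision, weak convergence is used only at two points T - c and
    T + c, because F_m and its derivative are monotone. Local uniformity comes from letting the
    point and m vary together, then from compactness. *)

(** * Toeplitz minors of elementary symmetric functions *)

Definition npos (R : realType) (s : seq R) : nat := count (fun x => 0 < x) s.

(** Integer indices, with value 0 below 0, spare the recursion and the Toeplitz minors all boundary
    cases. *)
Definition esym (R : realType) (s : seq R) (n : int) : R :=
  if n is Posz k then ecoef k (poly_of_roots s) else 0.

Lemma esym_nil (R : realType) (n : int) : esym (R := R) [::] n = (n == 0)%:R.
Proof.
case: n => [n|n] //=.
rewrite /ecoef /poly_of_roots big_nil size_poly1 /=.
by case: n => [|n] //=; rewrite expr0 mul1r coefC.
Qed.

Lemma size_poly_of_roots (R : realType) (s : seq R) :
  (size (poly_of_roots s)).-1 = size s.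
Proof. by rewrite /poly_of_roots size_prod_XsubC. Qed.

Lemma esym_cons (R : realType) (x : R) (s : seq R) (n : int) :
  esym (x :: s) n = esym s n + x * esym s (n - 1).
Proof.
case: n => [n|n]; last first.
  rewrite (_ : Negz n - 1 = Negz n.+1) //=; last by lia.
  by rewrite mulr0 addr0.
have -> : esym s (n%:Z - 1) = if n is k.+1 then ecoef k (poly_of_roots s) else 0.
  case: n => [|n] //.
  by rewrite (_ : n.+1%:Z - 1 = n%:Z) //; lia.
rewrite /= /ecoef !size_poly_of_roots /=.
have -> i : (poly_of_roots (x :: s))`_i =
    (if i is j.+1 then (poly_of_roots s)`_j else 0) - x * (poly_of_roots s)`_i.
  rewrite {1}/poly_of_roots big_cons mulrBl -commr_polyX coefB coefMX coefCM.
  by case: i.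
case: n => [|n] /=.
  rewrite subn0 /= !expr0 !mul1r mulr0 addr0 [X in _ - _ * X]nth_default ?mulr0 ?subr0 //.
  - by rewrite subn0.
  - by rewrite -(size_poly_of_roots s) leqSpred.
rewrite ltnS subSS.
case: (ltngtP n (size s)) => hn.
- have -> : (size s - n = (size s - n.+1).+1)%N by lia.
  by rewrite /= exprS; ring.
- by rewrite mulr0 addr0.
- by rewrite hn subnn /= exprS; ring.
Qed.

Lemma perm_esym (R : realType) (s t : seq R) (n : int) :
  perm_eq s t -> esym s n = esym t n.
Proof. by move=> st; rewrite /esym /poly_of_roots (perm_big _ st). Qed.

Lemma esym_ge0 (R : realType) (s : seq R) (n : int) :
  all (fun x => 0 <= x) s -> 0 <= esym s n.
Proof.
elim: s n => [|x s IHs] n; first by rewrite esym_nil ler0n.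
by move=> /= /andP[x0 s0]; rewrite esym_cons addr_ge0 ?mulr_ge0 ?IHs.
Qed.

Lemma esym_rem (R : realType) (s : seq R) (x : R) (n : int) : x \in s ->
  esym s n = esym (rem x s) n + x * esym (rem x s) (n - 1).
Proof. by move=> xs; rewrite (perm_esym n (perm_to_rem xs)) esym_cons. Qed.

(** Double counting: the term of x collects the n-subsets that contain x, so each n-subset appears n
    times in all. *)
Lemma sum_esym_rem (R : realType) (s : seq R) (n : int) :
  \sum_(x <- s) x * esym (rem x s) (n - 1) = n%:~R * esym s n.
Proof.
elim: s n => [|y s IHs] n.
  by rewrite big_nil esym_nil; case: eqP => [->|]; rewrite ?mul0r ?mulr0.
rewrite big_cons /= eqxx esym_cons.
rewrite (eq_big_seq (fun x => x * esym (rem x s) (n - 1)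
    + y * (x * esym (rem x s) (n - 1 - 1)))); last first.
  (* When x = y, removal drops the head and leaves [s], which is [y :: rem x s] up to a
     permutation. *)
  move=> x xs; rewrite (_ : esym _ _ = esym (y :: rem x s) (n - 1)).
    by rewrite esym_cons; ring.
  case: eqP => [->|//]; apply: perm_esym.
  exact: perm_to_rem.
rewrite big_split /= -big_distrr /= !IHs intrB; ring.
Qed.

(** These are the determinants whose column of index i is (f i, f (i-1)), respectively (f i, f
    (i-1), f (i-2)), expanded along the first row. *)
Definition toep2 (R : ringType) (f : int -> R) (i j : int) : R :=
  f i * f (j - 1) - f j * f (i - 1).

Definition toep3 (R : ringType) (f : int -> R) (i j k : int) : R :=
  f i * (f (j - 1) * f (k - 2) - f (k - 1) * f (j - 2))
  - f j * (f (i - 1) * f (k - 2) - f (k - 1) * f (i - 2))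
  + f k * (f (i - 1) * f (j - 2) - f (j - 1) * f (i - 2)).

(* Adding the root x replaces each Toeplitz column c_j by c_j + x c_(j-1), so by
   multilinearity a minor becomes a combination, with coefficients 1, x, x^2, ...,
   of minors whose columns are still in weakly increasing order. *)
Lemma toep2_esym_ge0 (R : realType) (s : seq R) (i j : int) :
  all (fun x => 0 <= x) s -> i <= j -> 0 <= toep2 (esym s) i j.
Proof.
elim: s i j => [|x s IHs] i j.
  move=> _ ij; rewrite /toep2 !esym_nil.
  by repeat (case: eqP => ? //=; try lia); rewrite ?(mulr0, mul0r, mulr1, subr0, subrr) ?ler01.
move=> /= /andP[x0 s0]; rewrite le_eqVlt => /orP[/eqP <-|ij].
  by rewrite /toep2 subrr.
have -> : toep2 (esym (x :: s)) i j = toep2 (esym s) i j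
   + x * toep2 (esym s) (i - 1) j + x * toep2 (esym s) i (j - 1)
   + x ^+ 2 * toep2 (esym s) (i - 1) (j - 1).
  by rewrite /toep2 !esym_cons; ring.
have pos (a b c d : R) : 0 <= a -> 0 <= b -> 0 <= c -> 0 <= d ->
    0 <= a + x * b + x * c + x ^+ 2 * d.
  by move=> *; rewrite !addr_ge0 ?mulr_ge0 ?sqr_ge0.
by apply: pos; apply: IHs => //; lia.
Qed.

Lemma toep3_esym_ge0 (R : realType) (s : seq R) (i j k : int) :
  all (fun x => 0 <= x) s -> i <= j -> j <= k -> 0 <= toep3 (esym s) i j k.
Proof.
elim: s i j k => [|x s IHs] i j k.
  move=> _ ij jk; rewrite /toep3 !esym_nil.
  by repeat (case: eqP => ? //=; try lia);
    rewrite ?(mulr0, mul0r, mulr1, subr0, subrr, addr0) ?ler01.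
move=> /= /andP[x0 s0]; rewrite le_eqVlt => /orP[/eqP <- _|ij].
  by rewrite (_ : toep3 _ _ _ _ = 0) // /toep3; ring.
rewrite le_eqVlt => /orP[/eqP <-|jk].
  by rewrite (_ : toep3 _ _ _ _ = 0) // /toep3; ring.
pose f := esym s.
have -> : toep3 (esym (x :: s)) i j k = toep3 f i j k
   + x * (toep3 f (i - 1) j k + toep3 f i (j - 1) k + toep3 f i j (k - 1))
   + x ^+ 2 * (toep3 f (i - 1) (j - 1) k + toep3 f (i - 1) j (k - 1)
      + toep3 f i (j - 1) (k - 1))
   + x ^+ 3 * toep3 f (i - 1) (j - 1) (k - 1).
  have E (n : int) : (n - 2 - 1 = n - 1 - 2)%R by ring.
  rewrite /toep3 !esym_cons -/f !E; ring.
have pos (a b c d e g h l : R) : 0 <= a -> 0 <= b -> 0 <= c -> 0 <= d ->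
    0 <= e -> 0 <= g -> 0 <= h -> 0 <= l ->
    0 <= a + x * (b + c + d) + x ^+ 2 * (e + g + h) + x ^+ 3 * l.
  by move=> *; rewrite !addr_ge0 ?mulr_ge0 ?addr_ge0 ?exprn_ge0.
by apply: pos; apply: IHs => //; lia.
Qed.

Definition newt (R : ringType) (f : int -> R) (n : int) : R :=
  f n ^+ 2 - f (n - 1) * f (n + 1).

(** A new root x contributes three nonnegative terms. If n was already in range, the first is
    positive; otherwise x > 0 and n is the one new index, for which the x^2 term is positive. *)
Lemma newt_esym_gt0 (R : realType) (s : seq R) (n : int) :
  all (fun x => 0 <= x) s -> 0 <= n -> n <= (npos s)%:Z ->
  0 < newt (esym s) n.
Proof.
have newtE (t : seq R) k : newt (esym t) k = toep2 (esym t) k (k + 1).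
  by rewrite /newt /toep2 addrK; ring.
elim: s n => [|x s IHs] n.
  move=> _ n0 /= n1; have -> : n = 0 by lia.
  by rewrite /newt !esym_nil /= mul0r subr0 expr1n.
move=> /= /andP[x0 s0] n0; rewrite [npos _]/= -/(npos s) => nN.
have -> : newt (esym (x :: s)) n = newt (esym s) n
   + x * toep2 (esym s) (n - 1) (n + 1) + x ^+ 2 * newt (esym s) (n - 1).
  by rewrite /newt /toep2 !esym_cons !addrK; ring.
have h1 : 0 <= newt (esym s) n by rewrite newtE toep2_esym_ge0 //; lia.
have h2 : 0 <= newt (esym s) (n - 1) by rewrite newtE toep2_esym_ge0 //; lia.
have h3 : 0 <= toep2 (esym s) (n - 1) (n + 1) by apply: toep2_esym_ge0 => //; lia.
have [nN'|nN'] := lerP n (npos s)%:Z.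
  rewrite -addrA; apply: ltr_pwDl; first exact: IHs.
  by apply: addr_ge0; apply: mulr_ge0; rewrite ?sqr_ge0.
have xp : 0 < x by move: nN nN'; case: (0 < x) => //=; lia.
rewrite xp add1n in nN.
apply: ltr_wpDl; first by apply: addr_ge0 => //; apply: mulr_ge0.
by apply: mulr_gt0; rewrite ?exprn_gt0 //; apply: IHs => //; lia.
Qed.

Lemma esym_gt0 (R : realType) (s : seq R) (n : int) :
  all (fun x => 0 <= x) s -> 0 <= n -> n <= (npos s)%:Z ->
  0 < esym s n.
Proof.
move=> s0 n0 nN; have := newt_esym_gt0 s0 n0 nN.
rewrite [0 < esym s n]lt0r esym_ge0 // andbT /newt; apply: contraTneq => ->.
by rewrite expr0n /= sub0r oppr_gt0 -leNgt mulr_ge0 ?esym_ge0.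
Qed.

Lemma newt_esym_ge0 (R : realType) (s : seq R) (n : int) :
  all (fun x => 0 <= x) s -> 0 <= newt (esym s) n.
Proof.
move=> s0; rewrite (_ : newt _ _ = toep2 (esym s) n (n + 1)).
  by apply: toep2_esym_ge0 => //; lia.
by rewrite /newt /toep2 addrK; ring.
Qed.

(** Dodgson condensation of the 3 x 3 minor with columns n, n+1, n+2: its central entry is e_n and
    its four corner minors are b_n, b_n, b_(n-1), b_(n+1). *)
Lemma newt_esym_logconcave (R : realType) (s : seq R) (n : int) :
  all (fun x => 0 <= x) s ->
  newt (esym s) (n - 1) * newt (esym s) (n + 1) <= newt (esym s) n ^+ 2.
Proof.
move=> s0; rewrite -subr_ge0.
rewrite (_ : _ - _ = esym s n * toep3 (esym s) n (n + 1) (n + 2)).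
  by rewrite mulr_ge0 ?esym_ge0 // toep3_esym_ge0 //; lia.
have E1 : n + 1 - 2 = n - 1 by ring.
have E2 : n + 2 - 1 = n + 1 by ring.
have E3 : n - 1 - 1 = n - 2 by ring.
have E4 : n + 1 + 1 = n + 2 by ring.
by rewrite /newt /toep3 !addrK ?subrK ?E1 ?E2 ?E3 ?E4; ring.
Qed.

(** * Ratios of consecutive elementary symmetric functions *)

Section SymRatio.
Variables (R : realType) (s : seq R).
Hypothesis s_ge0 : all (fun x => 0 <= x) s.
Let e := esym s.
Let N := npos s.

Definition sym_ratio (s : seq R) (k : nat) : R := esym s (k%:Z - 1) / esym s k%:Z.

Let rho := sym_ratio s.

Let e_gt0 k : (k <= N)%N -> 0 < e k%:Z.
Proof. by move=> kN; apply: esym_gt0 => //; lia. Qed.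

Lemma sym_ratio_gt0 k : (0 < k <= N)%N -> 0 < rho k.
Proof.
case: k => // k /andP[_ kN].
have E : k.+1%:Z - 1 = k%:Z by lia.
by rewrite /rho /sym_ratio E divr_gt0 ?e_gt0 // ltnW.
Qed.

Lemma sym_ratioB k : (0 < k < N)%N ->
  rho k.+1 - rho k = newt e k%:Z / (e k%:Z * e k.+1%:Z).
Proof.
move=> /andP[k0 kN]; rewrite /rho /sym_ratio /newt -/e.
have -> : k.+1%:Z - 1 = k%:Z by lia.
have -> : k%:Z + 1 = k.+1%:Z by lia.
have h1 : e k%:Z != 0 by rewrite gt_eqF // e_gt0 // ltnW.
have h2 : e k.+1%:Z != 0 by rewrite gt_eqF // e_gt0.
by field; rewrite h1 h2.
Qed.

Lemma sym_ratioB_gt0 k : (0 < k < N)%N -> 0 < rho k.+1 - rho k.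
Proof.
move=> kN; rewrite sym_ratioB //; case/andP: kN => k0 kN.
apply: divr_gt0; first by apply: newt_esym_gt0 => //; lia.
by apply: mulr_gt0; apply: e_gt0 => //; apply: ltnW.
Qed.

(** Passing from b_k to d_k = b_k/(e_k e_(k+1)) leaves the factor e_(k+1) e_(k+2)/(e_k e_(k+3)) =
    rho_(k+3)/rho_(k+1), here cross-multiplied. *)
Lemma sym_ratioB_logconcave k : (0 < k)%N -> (k.+3 <= N)%N ->
  rho k.+1 * ((rho k.+1 - rho k) * (rho k.+3 - rho k.+2))
    <= rho k.+3 * (rho k.+2 - rho k.+1) ^+ 2.
Proof.
move=> k0 kN; rewrite !sym_ratioB; try lia.
have := newt_esym_logconcave k.+1%:Z s_ge0; rewrite -/e.
have -> : k.+1%:Z - 1 = k%:Z by lia.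
have -> : k.+1%:Z + 1 = k.+2%:Z by lia.
rewrite /rho /sym_ratio -/e.
have -> : k.+1%:Z - 1 = k%:Z by lia.
have -> : k.+3%:Z - 1 = k.+2%:Z by lia.
have := @e_gt0 k; have := @e_gt0 k.+1; have := @e_gt0 k.+2; have := @e_gt0 k.+3.
move: (e k%:Z) (e k.+1%:Z) (e k.+2%:Z) (e k.+3%:Z) => a b c d.
move: (newt e k%:Z) (newt e k.+1%:Z) (newt e k.+2%:Z) => u v w.
move=> /(_ kN) d0 /(_ (ltnW kN)) c0 /(_ (ltnW (ltnW kN))) b0.
move=> /(_ (ltnW (ltnW (ltnW kN)))) a0 uw.
have -> : a / b * (u / (a * b) * (w / (c * d))) = (u * w) * (b ^+ 2 * c * d)^-1.
  by field; rewrite !gt_eqF.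
have -> : c / d * (v / (b * c)) ^+ 2 = v ^+ 2 * (b ^+ 2 * c * d)^-1.
  by field; rewrite !gt_eqF.
by apply: ler_wpM2r; rewrite // invr_ge0 !mulr_ge0 ?exprn_ge0 // ltW.
Qed.

Let newt_rem x n : x \in s -> 0 <= newt (esym (rem x s)) n.
Proof.
by move=> xs; apply: newt_esym_ge0; apply/allP => y /mem_rem; apply: (allP s_ge0).
Qed.

Let esym_rem_ge0 x n : x \in s -> 0 <= esym (rem x s) n.
Proof.
by move=> xs; apply: esym_ge0; apply/allP => y /mem_rem; apply: (allP s_ge0).
Qed.

(* Both bounds compare x rho/(1 + x rho) with the proportion x e_(k-1)(s \ x)/e_k(s)
   of k-subsets that contain x; these proportions add up to k. *)
Lemma sum_sym_ratio_le k : (0 < k <= N)%N ->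
  \sum_(x <- s) (x * rho k / (1 + x * rho k)) <= k%:R.
Proof.
move=> /andP[k0 kN]; have ek := e_gt0 kN.
rewrite -[leRHS](mulfK (lt0r_neq0 ek)) -(sum_esym_rem s k%:Z) mulr_suml.
rewrite big_seq [leRHS]big_seq; apply: ler_sum => x xs.
have x0 : 0 <= x by apply: (allP s_ge0).
have := @newt_rem x (k%:Z - 1) xs; rewrite /newt subrK.
have := @esym_rem_ge0 x k%:Z xs.
have := @esym_rem_ge0 x (k%:Z - 1) xs.
have := @esym_rem_ge0 x (k%:Z - 1 - 1) xs.
move: ek; rewrite /rho /sym_ratio /e !(esym_rem _ xs).
move: (esym _ _) (esym _ _) (esym _ _) => u v w.
(* Here w, v, u are e_k, e_(k-1), e_(k-2) of the roots other than x, while E and A are e_k and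
   e_(k-1) of all roots. The comparison reduces to Newton's inequality v^2 >= u w. *)
move=> E0 u0 v0 w0 uw; set E := w + x * v; set A := v + x * u.
have A0 : 0 <= A by rewrite addr_ge0 ?mulr_ge0.
have EA : 0 < E + x * A by rewrite ltr_wpDr ?mulr_ge0.
have -> : x * (A / E) / (1 + x * (A / E)) = x * A / (E + x * A).
  by field; rewrite !gt_eqF.
rewrite ler_pdivrMr // mulrAC ler_pdivlMr // -subr_ge0.
rewrite (_ : _ - _ = x ^+ 2 * (v ^+ 2 - u * w)); last by rewrite /E /A; ring.
by rewrite mulr_ge0 ?sqr_ge0.
Qed.

Lemma sum_sym_ratio_ge k : (k < N)%N ->
  k%:R <= \sum_(x <- s) (x * rho k.+1 / (1 + x * rho k.+1)).
Proof.
move=> kN; have ek := e_gt0 (ltnW kN); have ek1 := e_gt0 kN.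
rewrite -[leLHS](mulfK (lt0r_neq0 ek)) -(sum_esym_rem s k%:Z) mulr_suml.
rewrite big_seq [leRHS]big_seq; apply: ler_sum => x xs.
have x0 : 0 <= x by apply: (allP s_ge0).
have E1 : k.+1%:Z - 1 = k%:Z by lia.
have E2 : k%:Z + 1 = k.+1%:Z by lia.
have := @newt_rem x k%:Z xs; rewrite /newt E2.
have := @esym_rem_ge0 x k%:Z xs.
have := @esym_rem_ge0 x (k%:Z - 1) xs.
move: ek ek1; rewrite /rho /sym_ratio /e E1 !(esym_rem _ xs) E1.
move: (esym _ _) (esym _ _) (esym _ _) => z v w.
(* The proportion still concerns k-subsets but the ratio is rho_(k+1), so E and A are e_(k+1) and
   e_k, and Newton's inequality is needed one index higher. *)
move=> A0 E0 v0 w0 uw; set E := z + x * w in E0 *; set A := w + x * v in A0 *.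
have EA : 0 < E + x * A.
  by apply: ltr_wpDr => //; apply: mulr_ge0 => //; apply: ltW.
have -> : x * (A / E) / (1 + x * (A / E)) = x * A / (E + x * A).
  by field; rewrite !gt_eqF.
rewrite ler_pdivlMr // mulrAC ler_pdivrMr // -subr_ge0.
rewrite (_ : _ - _ = x * (w ^+ 2 - v * z)); last by rewrite /E /A; ring.
by rewrite mulr_ge0.
Qed.

End SymRatio.

(** * Almost log-concave sequences *)

Section Windows.
Variable R : realType.
Implicit Types (D : nat -> R) (eta : R).

(* Only the entries D_0, ..., D_L are constrained; a block of n entries must sum to n
   up to an absolute error 1 and a relative error eta. *)
Definition balanced (L : nat) eta D :=
  [/\ forall j, (j <= L)%N -> 0 < D j,
      forall j, (j.+2 <= L)%N -> D j * D j.+2 <= (1 + eta) * D j.+1 ^+ 2 &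
      forall i n, (i + n <= L.+1)%N -> (0 < n)%N ->
        (1 - eta) * (n%:R - 1) <= \sum_(l < n) D (i + l)%N <= (1 + eta) * (n%:R + 1)].

(** By this symmetry a bound on drops from left to right also bounds drops from right to left. *)
Lemma balanced_rev L eta D : balanced L eta D ->
  balanced L eta (fun j => D (L - j)%N).
Proof.
move=> [Dp Dc Ds]; split.
- by move=> j jL; apply: Dp; lia.
- move=> j jL; have := Dc (L - j.+2)%N; rewrite mulrC.
  have -> : (L - j.+2).+2 = (L - j)%N by lia.
  have -> : (L - j.+2).+1 = (L - j.+1)%N by lia.
  by apply; lia.
- move=> i n iL n0; have := Ds (L.+1 - (i + n))%N n.
  rewrite (reindex_inj rev_ord_inj) /=.
  rewrite (eq_bigr (fun l : 'I_n => D (L - (i + l))%N)).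
    by apply => //; lia.
  by move=> l _; congr D; have := ltn_ord l; lia.
Qed.

Lemma exprD1_le eta n : 0 <= eta <= 1 -> (1 + eta) ^+ n <= 1 + 2 ^+ n * eta.
Proof.
move=> /andP[e0 e1].
(* The constant 2^n - 1 makes the induction close with eta^2 <= eta; the constant 2^n would not. *)
suff h : (1 + eta) ^+ n <= 1 + (2 ^+ n - 1) * eta by apply: le_trans h _; lra.
elim: n => [|n IH]; first by rewrite !expr0 subrr mul0r addr0.
rewrite exprS; apply: le_trans (ler_wpM2l _ IH) _; first by rewrite addr_ge0.
have : 1 <= 2 ^+ n :> R by rewrite exprn_ege1 // ler1n.
rewrite [2 ^+ n.+1]exprS; set c := 2 ^+ n => c1.
have : (c - 1) * eta * eta <= (c - 1) * eta * 1.
  by rewrite ler_wpM2l // mulr_ge0 // subr_ge0.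
by lra.
Qed.

Lemma sum_geometric_le n (q : R) : 0 <= q < 1 ->
  \sum_(i < n) q ^+ i <= (1 - q)^-1.
Proof.
move=> /andP[q0 q1]; rewrite -(ler_pM2l (x := 1 - q)) ?subr_gt0 //.
rewrite mulfV ?gt_eqF ?subr_gt0 // -opprB mulNr -subrX1 opprB.
by rewrite gerBl exprn_ge0.
Qed.

(* If a ratio D_(p+1)/D_p were below 1 - tau, log-concavity would make D decay
   geometrically after p, and the block sums could not keep growing. *)
Lemma balanced_ratio L eta D (tau : R) n p : balanced L eta D ->
  0 < tau < 1 -> 0 <= eta <= 2^-1 -> 2 ^+ n * eta <= tau / 2 ->
  12 / tau + 1 < n%:R -> (p + n <= L)%N -> (1 - tau) * D p <= D p.+1.
Proof.
move=> [Dp Dc Ds] /andP[t0 t1] /andP[e0 e1] en nt pL.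
have n0 : (0 < n)%N.
  rewrite -(ltr_nat R); apply: lt_trans nt.
  by rewrite ltr_wpDl // divr_ge0 // ltW.
rewrite leNgt; apply/negP => Dlt.
(* Half of the gap tau is given up to absorb the accumulated factors (1 + eta)^i <= 1 + tau/2. *)
pose th := 1 - tau / 2.
(* Each ratio exceeds the preceding one by a factor 1 + eta at most, so a low ratio stays low. *)
have step i : (i < n)%N ->
    D (p + i).+1 <= ((1 + eta) ^+ i * (1 - tau)) * D (p + i)%N.
  elim: i => [|i IH] ilt; first by rewrite addn0 expr0 mul1r ltW.
  have Di : 0 < D (p + i)%N by apply: Dp; clear -pL ilt; lia.
  have Di1 : 0 < D (p + i).+1 by apply: Dp; clear -pL ilt; lia.
  rewrite addnS -(ler_pM2l Di).
  apply: le_trans (Dc _ _) _; first by clear -pL ilt; lia.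
  have := IH (ltnW ilt).
  rewrite [(1 + eta) ^+ i.+1]exprS [D _ ^+ 2]expr2; set c := (1 + eta) ^+ i => IH'.
  rewrite (_ : _ * (_ * _ * _ * _) =
    ((1 + eta) * D (p + i).+1) * (c * (1 - tau) * D (p + i)%N)); last by ring.
  by rewrite mulrA ler_wpM2l // mulr_ge0 ?ltW //; lra.
have step' i : (i < n)%N -> D (p + i).+1 <= th * D (p + i)%N.
  move=> ilt; apply: le_trans (step i ilt) _.
  apply: ler_wpM2r; first by apply/ltW/Dp; lia.
  have h : (1 + eta) ^+ i <= 1 + tau / 2.
    apply: le_trans (exprD1_le i _) _; first by lra.
    rewrite lerD2l; apply: le_trans _ en.
    by rewrite ler_wpM2r // ler_weXn2l ?ler1n // ltnW.
  apply: le_trans (ler_wpM2r _ h) _; first by lra.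
  by rewrite /th; nra.
have thp : 0 <= th < 1 by rewrite /th; apply/andP; split; lra.
have geo i : (i <= n)%N -> D (p + i)%N <= th ^+ i * D p.
  elim: i => [|i IH] ilt; first by rewrite addn0 expr0 mul1r.
  rewrite addnS; apply: le_trans (step' i ilt) _.
  by rewrite exprS -mulrA ler_wpM2l ?IH ?(ltnW ilt) //; case/andP: thp.
have Dp3 : D p <= 3.
  have := Ds p 1%N; rewrite big_ord1 addn0 => /(_ _ isT)/andP[]; first by clear -pL n0; lia.
  by move=> _ h; apply: le_trans h _; lra.
have := Ds p n; case/(_ _ n0)/andP; first by clear -pL; lia.
(* The geometric series bounds the block by 6/tau, but the block sum is at least (n - 1)/2 > 6/tau;
   hence the 12 in the hypothesis. *)
move=> h _; have : (1 - eta) * (n%:R - 1) <= 3 * (tau / 2)^-1.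
  apply: le_trans h _.
  apply: le_trans (_ : _ <= \sum_(l < n) th ^+ l * D p) _.
    by apply: ler_sum => l _; apply: geo; apply: ltnW.
  rewrite -mulr_suml mulrC.
  have -> : (tau / 2)^-1 = (1 - th)^-1 by rewrite /th; congr (_^-1); ring.
  rewrite ler_pM ?sum_geometric_le //; first by apply/ltW/Dp; clear -pL; lia.
  by apply: sumr_ge0 => l _; rewrite exprn_ge0 //; case/andP: thp.
rewrite invfM invrK.
have : 2^-1 * (n%:R - 1) <= (1 - eta) * (n%:R - 1) :> R.
  by rewrite ler_wpM2r ?subr_ge0 ?ler1n //; lra.
move: nt; set u := tau^-1; rewrite mulrC -/u; nra.
Qed.

Lemma bernoulli_le (tau : R) n : 0 <= tau <= 1 -> 1 - n%:R * tau <= (1 - tau) ^+ n.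
Proof.
move=> /andP[t0 t1]; elim: n => [|n IH]; first by rewrite expr0 mul0r subr0.
rewrite exprS; apply: le_trans (_ : _ <= (1 - tau) * (1 - n%:R * tau)) _.
  have : 0 <= n%:R * tau * tau by rewrite !mulr_ge0.
  by rewrite -[n.+1]addn1 natrD; nra.
by rewrite ler_wpM2l // subr_ge0.
Qed.

(** If D drops slowly after p, all l entries of the block are at least (1 - l tau) D_p, so a large
    D_p would overfill it. *)
Lemma balanced_center_le L eta D (tau : R) l p : balanced L eta D ->
  0 < tau < 1 -> (0 < l)%N ->
  (forall j, (p <= j)%N -> (j < p + l)%N -> (1 - tau) * D j <= D j.+1) ->
  (p + l <= L)%N ->
  l%:R * (1 - l%:R * tau) * D p <= (1 + eta) * (l%:R + 1).
Proof.
move=> [Dp Dc Ds] /andP[t0 t1] l0 hD pL.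
have D0 : 0 < D p by apply: Dp; lia.
have geo i : (i <= l)%N -> (1 - tau) ^+ i * D p <= D (p + i)%N.
  elim: i => [|i IH] il; first by rewrite expr0 mul1r addn0.
  rewrite exprS -mulrA addnS; apply: le_trans (hD _ _ _); try lia.
  by rewrite ler_wpM2l ?IH ?(ltnW il) // subr_ge0 ltW.
have := Ds p l; case/(_ _ l0)/andP; first by lia.
move=> _; apply: le_trans.
have -> : l%:R * (1 - l%:R * tau) * D p
    = \sum_(i < l) (1 - l%:R * tau) * D p.
  by rewrite sumr_const card_ord -mulrA mulr_natl.
apply: ler_sum => i _; apply: le_trans (geo i (ltnW (ltn_ord i))).
apply: (ler_wpM2r (ltW D0)).
apply: le_trans (bernoulli_le i _); last by rewrite !ltW.
by rewrite lerD2l lerN2 (ler_wpM2r (ltW t0)) // ler_nat ltnW.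
Qed.

(** If D grows slowly after p, then (1 - l tau) times any entry of the block is at most D_p, so a
    small D_p could not fill it. *)
Lemma balanced_center_ge L eta D (tau : R) l p : balanced L eta D ->
  0 < tau < 1 -> (0 < l)%N -> l%:R * tau <= 1 ->
  (forall j, (p <= j)%N -> (j < p + l)%N -> (1 - tau) * D j.+1 <= D j) ->
  (p + l <= L)%N ->
  (1 - l%:R * tau) * ((1 - eta) * (l%:R - 1)) <= l%:R * D p.
Proof.
move=> [Dp Dc Ds] /andP[t0 t1] l0 lt1 hD pL.
have D0 : 0 < D p by apply: Dp; lia.
have geo i : (i <= l)%N -> (1 - tau) ^+ i * D (p + i)%N <= D p.
  elim: i => [|i IH] il; first by rewrite expr0 mul1r addn0.
  rewrite exprSr -mulrA addnS; apply: le_trans (IH (ltnW il)).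
  rewrite ler_wpM2l ?exprn_ge0 ?subr_ge0 ?(ltW t1) //.
  by apply: hD; lia.
have := Ds p l; case/(_ _ l0)/andP; first by lia.
move=> h _; rewrite -subr_ge0 in lt1.
apply: le_trans (ler_wpM2l lt1 h) _.
rewrite mulr_sumr.
have -> : l%:R * D p = \sum_(i < l) D p by rewrite sumr_const card_ord mulr_natl.
apply: ler_sum => i _; apply: le_trans (geo i (ltnW (ltn_ord i))).
rewrite ler_wpM2r ?(ltW (Dp _ _)) //; first by have := ltn_ord i; lia.
apply: le_trans (bernoulli_le i _); last by rewrite !ltW.
by rewrite lerD2l lerN2 (ler_wpM2r (ltW t0)) // ler_nat ltnW.
Qed.

(* Choose l ~ 1/eps, then tau = 1/l^2, then a window n ~ 1/tau on either side,
   then eta. *)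
Lemma balanced_center (eps : R) : 0 < eps ->
  exists p L : nat, exists2 eta, 0 < eta <= 2^-1 &
    (p <= L)%N /\ forall D, balanced L eta D -> `|D p - 1| <= eps.
Proof.
move=> eps0.
have [l l0 lle] : exists2 l : nat, (1 < l)%N & 20 / eps + 20 <= l%:R.
  have h0 : 0 <= 20 / eps + 20 by rewrite addr_ge0 // divr_ge0 // ltW.
  exists (Num.truncn (20 / eps + 20)).+1.
    rewrite ltnS -(ltr_nat R); have := truncnS_gt (20 / eps + 20).
    have : 0 <= 20 / eps by rewrite divr_ge0 // ltW.
    by rewrite -natr1; lra.
  by apply/ltW/truncnS_gt.
have lp : 0 < l%:R :> R by rewrite ltr0n ltnW.
pose tau : R := (l%:R ^+ 2)^-1.
have l1 : 1 < l%:R :> R by rewrite ltr1n.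
have tau01 : 0 < tau < 1.
  by rewrite /tau invr_gt0 exprn_gt0 //= invf_lt1 ?exprn_gt0 // exprn_egt1.
have ltau : l%:R * tau = l%:R^-1 by rewrite /tau expr2 invfM mulrA mulfV ?mul1r ?gt_eqF.
have [n nt] : exists n : nat, 12 / tau + 1 < n%:R.
  by exists (Num.truncn (12 / tau + 1)).+1; apply: truncnS_gt.
have n2 : 1 <= 2 ^+ n :> R by rewrite exprn_ege1 // ler1n.
pose eta := tau / 2 / 2 ^+ n.
have /andP[t0 t1] := tau01.
have eta0 : 0 < eta by rewrite /eta !divr_gt0 // exprn_gt0.
have eta1 : eta <= tau / 2.
  by rewrite /eta ler_pdivrMr ?exprn_gt0 // ler_peMr // divr_ge0 // ltW.
(* To the right of the centre lie a block of l entries and n more for testing the ratios inside it;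
   the reversed test needs n entries to the left. *)
exists (l + n)%N, (l + n + l + n)%N, eta; first by rewrite eta0; lra.
split=> [|D bD]; first by clear; lia.
have en : 2 ^+ n * eta <= tau / 2 by rewrite /eta mulrC divfK // gt_eqF // exprn_gt0.
have eta01 : 0 <= eta <= 2^-1 by rewrite ltW //; lra.
have up : l%:R * (1 - l%:R * tau) * D (l + n)%N <= (1 + eta) * (l%:R + 1).
  apply: (balanced_center_le bD tau01); [exact: ltnW| |clear; lia].
  by move=> j j1 j2; apply: (balanced_ratio (n := n) bD) => //; clear -j2; lia.
have dn : (1 - l%:R * tau) * ((1 - eta) * (l%:R - 1)) <= l%:R * D (l + n)%N.
  apply: (balanced_center_ge bD tau01); [exact: ltnW| | |clear; lia].
    by rewrite ltau invf_le1 // ltW.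
  move=> j j1 j2.
  have := balanced_ratio (n := n) (p := (l + n + l + n - j.+1)%N) (balanced_rev bD)
    tau01 eta01 en nt.
  have -> : (l + n + l + n - (l + n + l + n - j.+1) = j.+1)%N by clear -j2; lia.
  have -> : (l + n + l + n - (l + n + l + n - j.+1).+1 = j)%N by clear -j2; lia.
  by apply; clear -j1 j2; lia.
rewrite ltau in up dn.
set u := l%:R^-1 in up dn.
have lu : l%:R * u = 1 by rewrite /u mulfV // gt_eqF.
have u0 : 0 < u by rewrite invr_gt0.
have ue : 20 * u <= eps.
  rewrite /u ler_pdivrMr //; have := ler_wpM2l (ltW eps0) lle.
  rewrite mulrDr mulrCA mulfV ?gt_eqF // mulr1; have : 0 <= eps * 20 by lra.
  by lra.
have u20 : 20 * u <= 1 by rewrite /u ler_pdivrMr // mul1r; apply: le_trans lle; rewrite lerDr divr_ge0 // ltW.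
have eu : eta <= u.
  apply: le_trans eta1 _; rewrite /tau -/u expr2 invfM -/u.
  have : u * u <= u * 1 by rewrite ler_wpM2l // ?ltW //; lra.
  by lra.
(* With u = 1/l = l tau and eta <= u, division by l gives (1 - u)^3 <= d <= (1 + u)^2/(1 - u). Both
   ends are within 20 u <= eps of 1, which is why l was taken above 20/eps + 20. *)
move: up dn; set d := D _ => up dn.
have {}up : (1 - u) * d <= (1 + u) * (1 + u).
  have := ler_wpM2l (ltW u0) up.
  have -> : u * (l%:R * (1 - u) * d) = (1 - u) * d.
    by rewrite !mulrA [u * _]mulrC lu mul1r.
  rewrite mulrCA mulrDr [u * _]mulrC lu mulr1 => h; apply: le_trans h _.
  by rewrite ler_wpM2r ?lerD2l // addr_ge0 // ltW.
have {}dn : (1 - u) * ((1 - u) * (1 - u)) <= d.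
  have := ler_wpM2l (ltW u0) dn.
  rewrite [u * (l%:R * d)]mulrA [u * l%:R]mulrC lu mul1r.
  rewrite mulrCA [u * ((1 - eta) * _)]mulrCA mulrBr [u * l%:R]mulrC lu mulr1.
  move=> h; apply: le_trans h.
  by rewrite ler_wpM2l ?subr_ge0 ?ler_wpM2r ?subr_ge0 ?lerD2l ?lerN2 //; lra.
clear - up dn u0 ue u20.
have uu : u * u <= u / 20 by rewrite ler_wpM2l ?(ltW u0) //; lra.
have uu0 : 0 <= u * u by rewrite mulr_ge0 ?(ltW u0).
have uuu : u * u * u <= u * u by rewrite ler_piMr ?mulr_ge0 ?(ltW u0) //; lra.
have {}up : d <= 1 + 20 * u.
  rewrite -(ler_pM2l (x := 1 - u)); last by lra.
  by apply: le_trans up _; lra.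
by rewrite ler_norml; apply/andP; split; lra.
Qed.

End Windows.

(** * The moment transform and its inverse *)

Section Kernels.
Variable R : realType.
Implicit Types (t s x : R).

(* The absolute values make both kernels continuous and bounded on the whole line. *)
Definition phi t x : R := `|x| * t / (1 + `|x| * t).
Definition gam t x : R := `|x| / (1 + `|x| * t) ^+ 2.

Let den_gt0 t x : 0 < t -> 0 < 1 + `|x| * t.
Proof. by move=> t0; rewrite ltr_pwDl // mulr_ge0 // ltW. Qed.

Lemma phi_ge0 t x : 0 < t -> 0 <= phi t x.
Proof. by move=> t0; rewrite divr_ge0 ?mulr_ge0 ?(ltW (den_gt0 _ _)) // ltW. Qed.

Lemma phi_le1 t x : 0 < t -> phi t x <= 1.
Proof. by move=> t0; rewrite ler_pdivrMr ?den_gt0 // mul1r lerDr. Qed.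

Lemma phi_le t x : 0 < t -> phi t x <= `|x| * t.
Proof.
move=> t0; rewrite ler_pdivrMr ?den_gt0 // ler_peMr ?mulr_ge0 ?(ltW t0) //.
by rewrite lerDl mulr_ge0 ?(ltW t0).
Qed.

Lemma gam_ge0 t x : 0 < t -> 0 <= gam t x.
Proof. by move=> t0; rewrite divr_ge0 // exprn_ge0 // ltW // den_gt0. Qed.

Lemma gam_le t x : 0 < t -> gam t x <= t^-1.
Proof.
move=> t0; have d := den_gt0 x t0.
rewrite ler_pdivrMr ?exprn_gt0 // ler_pdivlMl // mulrC.
have : 0 <= `|x| * t by rewrite mulr_ge0 // ltW.
by nra.
Qed.

Let phiB t s x : 0 < t -> 0 < s ->
  phi s x - phi t x = (s - t) * (`|x| / ((1 + `|x| * s) * (1 + `|x| * t))).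
Proof.
move=> t0 s0; rewrite /phi; field.
by rewrite !gt_eqF ?den_gt0.
Qed.

(** [phi] is concave in t with derivative [gam], so its difference quotient lies between [gam] at
    the two ends. These pointwise bounds integrate against mu and against root counting measures
    alike, in place of differentiation under the integral. *)
Lemma phiB_le t s x : 0 < t -> t <= s -> phi s x - phi t x <= (s - t) * gam t x.
Proof.
move=> t0 ts; have s0 := lt_le_trans t0 ts.
rewrite phiB // ler_wpM2l ?subr_ge0 // ler_wpM2l //.
rewrite lef_pV2 ?posrE ?mulr_gt0 ?exprn_gt0 ?den_gt0 // expr2.
by rewrite ler_wpM2r ?(ltW (den_gt0 _ _)) // lerD2l ler_wpM2l.
Qed.

Lemma phiB_ge t s x : 0 < t -> t <= s -> (s - t) * gam s x <= phi s x - phi t x.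
Proof.
move=> t0 ts; have s0 := lt_le_trans t0 ts.
rewrite phiB // ler_wpM2l ?subr_ge0 // ler_wpM2l //.
rewrite lef_pV2 ?posrE ?mulr_gt0 ?exprn_gt0 ?den_gt0 // expr2.
by rewrite ler_wpM2l ?(ltW (den_gt0 _ _)) // lerD2l ler_wpM2l.
Qed.

Lemma gam_anti t s x : 0 < t -> t <= s -> gam s x <= gam t x.
Proof.
move=> t0 ts; have s0 := lt_le_trans t0 ts.
rewrite ler_wpM2l // lef_pV2 ?posrE ?exprn_gt0 ?den_gt0 //.
by rewrite ler_pXn2r ?nnegrE ?(ltW (den_gt0 _ _)) // lerD2l ler_wpM2l.
Qed.

(** A Lipschitz bound in t that is uniform in x, so that it survives integration and makes [Gint]
    continuous. *)
Lemma gamB_le t s x : 0 < t -> t <= s ->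
  gam t x - gam s x <= (s - t) * (2 / t ^+ 2).
Proof.
move=> t0 ts; have s0 := lt_le_trans t0 ts.
have a0 : 0 <= `|x| by [].
have dt := den_gt0 x t0; have ds := den_gt0 x s0.
rewrite /gam; move: `|x| a0 dt ds => a a0 dt ds.
have -> : a / (1 + a * t) ^+ 2 - a / (1 + a * s) ^+ 2 =
   (s - t) * (a ^+ 2 * (2 + a * s + a * t) / ((1 + a * t) ^+ 2 * (1 + a * s) ^+ 2)).
  by field; rewrite !gt_eqF.
rewrite ler_wpM2l ?subr_ge0 // ler_pdivrMr ?mulr_gt0 ?exprn_gt0 //.
rewrite [leRHS]mulrAC ler_pdivlMr ?exprn_gt0 //.
have h1 : a ^+ 2 * t ^+ 2 <= (1 + a * t) ^+ 2.
  rewrite -exprMn ler_pXn2r ?nnegrE ?(ltW dt) ?mulr_ge0 ?(ltW t0) //.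
  by rewrite lerDr.
have h2 : 2 + a * s + a * t <= 2 * (1 + a * s) ^+ 2.
  have as0 : 0 <= a * s by rewrite mulr_ge0 // ltW.
  have ats : a * t <= a * s by rewrite ler_wpM2l.
  by have := sqr_ge0 (a * s); nra.
rewrite mulrAC [leRHS](_ : _ = (1 + a * t) ^+ 2 * (2 * (1 + a * s) ^+ 2)).
  apply: ler_pM => //; first by rewrite mulr_ge0 ?sqr_ge0.
  by rewrite !addr_ge0 ?mulr_ge0 // ltW.
by ring.
Qed.

Lemma continuous_phi t : 0 < t -> continuous (phi t).
Proof.
move=> t0 x; have h : (fun y => `|y| * t) @ x --> `|x| * t.
  by apply: cvgMl; apply: cvg_norm; exact: cvg_id.
apply: cvgM => //; apply: cvgV; first by rewrite gt_eqF // den_gt0.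
by apply: cvgD => //; exact: cvg_cst.
Qed.

Lemma continuous_gam t : 0 < t -> continuous (gam t).
Proof.
move=> t0 x; have h : (fun y => `|y| * t) @ x --> `|x| * t.
  by apply: cvgMl; apply: cvg_norm; exact: cvg_id.
apply: cvgM; first by apply: cvg_norm; exact: cvg_id.
apply: cvgV; first by rewrite gt_eqF // exprn_gt0 // den_gt0.
by rewrite expr2; apply: cvgM; apply: cvgD => //; exact: cvg_cst.
Qed.

End Kernels.

Section Moments.
Variables (R : realType) (mu : probability R R).

Definition Fint (t : R) : R := \int[mu]_x phi t x.
Definition Gint (t : R) : R := \int[mu]_x gam t x.

Let bounded_continuous_integrable (f : R -> R) (M : R) : continuous f ->
  (forall x, `|f x| <= M) -> mu.-integrable setT (EFin \o f).
Proof.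
move=> cf fM; apply: measurable_bounded_integrable => //.
- by rewrite (le_lt_trans (probability_le1 mu measurableT)) // ltry.
- exact: continuous_measurable_fun.
- exists M; split => //; first exact: num_real.
  by move=> y My x _ /=; apply: le_trans (fM x) (ltW My).
Qed.

Lemma integrable_phi t : 0 < t -> mu.-integrable setT (EFin \o phi t).
Proof.
move=> t0; apply: (@bounded_continuous_integrable _ 1); first exact: continuous_phi.
by move=> x; rewrite ger0_norm ?phi_ge0 ?phi_le1.
Qed.

Lemma integrable_gam t : 0 < t -> mu.-integrable setT (EFin \o gam t).
Proof.
move=> t0; apply: (@bounded_continuous_integrable _ t^-1); first exact: continuous_gam.
by move=> x; rewrite ger0_norm ?gam_ge0 ?gam_le.
Qed.

Let Rintegral_cst_prob (r : R) : \int[mu]_x r = r.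
Proof.
have E : (\int[mu]_x r%:E = r%:E * 1)%E.
  rewrite -(probability_setT mu); exact: integral_cst.
by rewrite /Rintegral E mule1.
Qed.

Lemma Gint_ge0 t : 0 < t -> 0 <= Gint t.
Proof. by move=> t0; apply: Rintegral_ge0 => x _; apply: gam_ge0. Qed.

Lemma FintB_le t s : 0 < t -> t <= s -> Fint s - Fint t <= (s - t) * Gint t.
Proof.
move=> t0 ts; have s0 := lt_le_trans t0 ts.
rewrite -RintegralB ?integrable_phi // -RintegralZl ?integrable_gam //.
apply: le_Rintegral => //.
- rewrite (_ : _ \o _ = (EFin \o phi s) \- (EFin \o phi t))%E //.
  by apply: integrableB => //; apply: integrable_phi.
- rewrite (_ : _ \o _ = (fun x => (s - t)%:E * (EFin \o gam t) x))%E //.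
  by apply: integrableZl => //; apply: integrable_gam.
- by move=> x _; apply: phiB_le.
Qed.

Lemma FintB_ge t s : 0 < t -> t <= s -> (s - t) * Gint s <= Fint s - Fint t.
Proof.
move=> t0 ts; have s0 := lt_le_trans t0 ts.
rewrite -RintegralB ?integrable_phi // -RintegralZl ?integrable_gam //.
apply: le_Rintegral => //.
- rewrite (_ : _ \o _ = (fun x => (s - t)%:E * (EFin \o gam s) x))%E //.
  by apply: integrableZl => //; apply: integrable_gam.
- rewrite (_ : _ \o _ = (EFin \o phi s) \- (EFin \o phi t))%E //.
  by apply: integrableB => //; apply: integrable_phi.
- by move=> x _; apply: phiB_ge.
Qed.

Lemma Gint_anti t s : 0 < t -> t <= s -> Gint s <= Gint t.
Proof.
move=> t0 ts; have s0 := lt_le_trans t0 ts.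
by apply: le_Rintegral; rewrite ?integrable_gam // => x _; apply: gam_anti.
Qed.

Lemma GintB_le t s : 0 < t -> t <= s -> Gint t - Gint s <= (s - t) * (2 / t ^+ 2).
Proof.
move=> t0 ts; have s0 := lt_le_trans t0 ts.
rewrite -RintegralB ?integrable_gam //.
have <- : \int[mu]_x ((s - t) * (2 / t ^+ 2)) = (s - t) * (2 / t ^+ 2).
  exact: Rintegral_cst_prob.
apply: le_Rintegral => //.
- rewrite (_ : _ \o _ = (EFin \o gam t) \- (EFin \o gam s))%E //.
  by apply: integrableB => //; apply: integrable_gam.
- by apply: (bounded_continuous_integrable (M := `|(s - t) * (2 / t ^+ 2)|)) => // x; apply: cvg_cst.
- by move=> x _; apply: gamB_le.
Qed.

Let Fint_dominated (u : R ^nat) (g : R -> R) :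
  (forall n, 0 < u n) -> measurable_fun setT g ->
  (forall x, (fun n => phi (u n) x) @ \oo --> g x) ->
  (fun n => Fint (u n)) @ \oo --> \int[mu]_x g x.
Proof.
move=> u0 mg cg.
have [|||||ig _ h] := @dominated_convergence _ _ _ mu setT measurableT
  (fun n => EFin \o phi (u n)) (EFin \o g) (cst 1%E).
- by move=> n; case/integrableP: (integrable_phi (u0 n)).
- exact/measurable_EFinP.
- by apply: aeW => x _; apply: cvg_EFin; [exact: nearW|exact: cg].
- exact: finite_measure_integrable_cst.
- by apply: aeW => x n _ /=; rewrite lee_fin ger0_norm ?phi_ge0 ?phi_le1.
apply: fine_cvg; rewrite /Rintegral fineK //.
by apply: integrable_fin_num.
Qed.

Lemma Fint_small (v : R) : 0 < v -> exists2 t, 0 < t & Fint t < v.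
Proof.
move=> v0; pose u n : R := n.+1%:R^-1.
have u0 n : 0 < u n by rewrite invr_gt0.
have : (fun n => Fint (u n)) @ \oo --> \int[mu]_x (cst 0 x : R).
  apply: Fint_dominated => // x.
  apply: (@squeeze_cvgr _ _ _ _ (cst 0) (fun n => `|x| * u n)).
  - by apply: nearW => n; rewrite phi_ge0 // phi_le.
  - exact: cvg_cst.
  - rewrite -[0](mulr0 `|x|); apply: cvgMr; exact: cvg_harmonic.
rewrite (Rintegral_cst_prob 0) => h.
have [n _ /(_ n (leqnn n)) /= hn] := cvgr_lt _ h _ v0.
by exists (u n).
Qed.

(** As t grows, [phi t] tends to the indicator of the nonzero reals, so F tends to 1 - mu{0}: this
    is the right end of the range of v. *)
Lemma Fint_large (v : R) : v < 1 - fine (mu [set 0]) ->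
  exists2 t, 0 < t & v < Fint t.
Proof.
move=> v0; pose u n : R := n.+1%:R.
have u0 n : 0 < u n by rewrite ltr0n.
have : (fun n => Fint (u n)) @ \oo --> \int[mu]_x (\1_(~` [set 0 : R]) x : R).
  apply: Fint_dominated => //.
    by apply: measurable_indic; exact: measurableC.
  move=> x; rewrite indicE; have [->|x0] := eqVneq x 0.
    rewrite memNset; last by move=> /(_ erefl).
    rewrite (_ : (fun n => _) = cst 0); first exact: cvg_cst.
    by apply/funext => n; rewrite /phi normr0 !mul0r.
  rewrite mem_set; last by move=> /= /eqP; rewrite (negbTE x0).
  have ax : 0 < `|x| by rewrite normr_gt0.
  apply: (@squeeze_cvgr _ _ _ _ (fun n => 1 - `|x|^-1 * n.+1%:R^-1) (cst 1)).
  - apply: nearW => n; rewrite phi_le1 // andbT /phi.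
    have d0 : 0 < `|x| * u n by rewrite mulr_gt0.
    rewrite -invfM -/(u n); move: (`|x| * u n) d0 => d d0.
    rewrite ler_pdivlMr; last by lra.
    have dd : d * d^-1 = 1 by rewrite mulfV // gt_eqF.
    have : 0 < d^-1 by rewrite invr_gt0.
    by nra.
  - rewrite -[X in _ --> X]subr0 -[X in _ --> _ - X](mulr0 `|x|^-1).
    apply: cvgB; first exact: cvg_cst.
    by apply: cvgMr; exact: cvg_harmonic.
  - exact: cvg_cst.
have -> : \int[mu]_x (\1_(~` [set 0 : R]) x : R) = 1 - fine (mu [set 0]).
  have E : (\int[mu]_x (\1_(~` [set 0%R : R]) x)%:E = 1 - mu [set 0%R : R])%E.
    rewrite -(probability_setC mu) // -[in RHS](setIT (~` _)).
    by apply: integral_indic => //; exact: measurableC.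
  rewrite /Rintegral E fineB //.
  exact: fin_num_measure.
move=> h.
have [n _ /(_ n (leqnn n)) /= hn] := cvgr_gt _ h _ v0.
by exists (u n).
Qed.

Lemma Fint_le t s : 0 < t -> t <= s -> Fint t <= Fint s.
Proof.
move=> t0 ts; rewrite -subr_ge0; apply: le_trans (FintB_ge t0 ts).
by rewrite mulr_ge0 ?subr_ge0 // Gint_ge0 // (lt_le_trans t0).
Qed.

(** By concavity a zero slope at t would keep F at the level F(t) ever after, although F still takes
    larger values. *)
Lemma Gint_gt0 t : 0 < t -> Fint t < 1 - fine (mu [set 0]) -> 0 < Gint t.
Proof.
move=> t0 /Fint_large[s s0 ts].
have {}ts' : t <= s.
  by rewrite leNgt; apply/negP => /ltW st; have := Fint_le s0 st; rewrite leNgt ts.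
rewrite lt0r Gint_ge0 // andbT; apply/eqP => G0.
by have := FintB_le t0 ts'; rewrite G0 mulr0 subr_le0 leNgt ts.
Qed.

Lemma Fint_lt t s : 0 < t -> t < s -> Fint t < 1 - fine (mu [set 0]) ->
  Fint t < Fint s.
Proof.
move=> t0 ts Ft; have s0 := lt_trans t0 ts.
rewrite lt_neqAle Fint_le ?(ltW ts) // andbT; apply/eqP => Fts.
have := FintB_ge t0 (ltW ts); rewrite Fts subrr leNgt mulr_gt0 ?subr_gt0 //.
by apply: Gint_gt0; rewrite // -Fts.
Qed.

Lemma continuous_Gint (t : R) : 0 < t -> {for t, continuous Gint}.
Proof.
(* 8/t^2 = 2/(t/2)^2 is the Lipschitz constant on the half-line beyond t/2. *)
move=> t0; have K0 : 0 < 8 / t ^+ 2 by rewrite divr_gt0 ?exprn_gt0.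
have gK z : t / 2 < z -> `|Gint t - Gint z| <= `|t - z| * (8 / t ^+ 2).
  move=> tz; have z0 : 0 < z by apply: lt_trans tz; rewrite divr_gt0.
  have [zt|zt] := lerP z t.
    rewrite ler0_norm ?subr_le0 ?Gint_anti // opprB.
    apply: le_trans (GintB_le z0 zt) _; rewrite ler_wpM2l ?subr_ge0 //.
    rewrite ler_pdivrMr ?exprn_gt0 // mulrAC ler_pdivlMr ?exprn_gt0 //.
    have : (t / 2) ^+ 2 <= z ^+ 2.
      by rewrite ler_pXn2r ?nnegrE ?(ltW z0) ?(ltW tz) // divr_ge0 // ltW.
    by rewrite expr_div_n; lra.
  rewrite ger0_norm ?subr_ge0 ?Gint_anti ?(ltW zt) //.
  apply: le_trans (GintB_le t0 (ltW zt)) _; rewrite ler_wpM2l ?subr_ge0 ?(ltW zt) //.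
  by rewrite ler_wpM2r ?invr_ge0 ?exprn_ge0 ?(ltW t0) //; lra.
apply/cvgrPdist_lt => e e0.
near=> z; apply: le_lt_trans (gK z _) _.
  by near: z; apply: lt_nbhsr; rewrite ltr_pdivrMr // ltr_pMr //; lra.
rewrite -ltr_pdivlMr //; near: z.
apply: (@cvgr_dist_lt _ _ _ (nbhs t) _ id t) => //.
by rewrite divr_gt0.
Unshelve. all: by end_near. Qed.

(** The difference quotient at z lies between [Gint t] and [Gint z], so the continuity of [Gint]
    yields Caratheodory's criterion. *)
Lemma is_derive_Fint (t : R) : 0 < t -> is_derive t 1 Fint (Gint t).
Proof.
move=> t0; apply/is_derive1_caratheodory.
pose g z := if z == t then Gint t else (Fint z - Fint t) / (z - t).
exists g; split; last by rewrite /g eqxx.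
  move=> z; rewrite /g; case: eqP => [->|/eqP]; first by rewrite !subrr mulr0.
  by rewrite -subr_eq0 => /divfK ->.
have gG z : 0 < z -> `|Gint t - g z| <= `|Gint t - Gint z|.
  move=> z0; rewrite /g; case: eqP => [->|/eqP] //.
  rewrite neq_lt => /orP[zt|zt].
    have zt' : 0 < t - z by rewrite subr_gt0.
    have h1 : Gint t <= (Fint z - Fint t) / (z - t).
      rewrite -[Fint z - _]opprB -[z - t]opprB invrN mulrNN ler_pdivlMr // mulrC.
      exact: FintB_ge (ltW zt).
    have h2 : (Fint z - Fint t) / (z - t) <= Gint z.
      rewrite -[Fint z - _]opprB -[z - t]opprB invrN mulrNN ler_pdivrMr // mulrC.
      exact: FintB_le (ltW zt).
    by rewrite !ler0_norm ?subr_le0 ?(le_trans h1) // lerN2 lerB.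
  have zt' : 0 < z - t by rewrite subr_gt0.
  have h1 : Gint z <= (Fint z - Fint t) / (z - t).
    by rewrite ler_pdivlMr // mulrC; exact: FintB_ge (ltW zt).
  have h2 : (Fint z - Fint t) / (z - t) <= Gint t.
    by rewrite ler_pdivrMr // mulrC; exact: FintB_le (ltW zt).
  by rewrite !ger0_norm ?subr_ge0 ?(le_trans h1) // lerB.
have gt : g t = Gint t by rewrite /g eqxx.
rewrite /prop_for /continuous_at gt; apply/cvgrPdist_lt => e e0.
near=> z; apply: le_lt_trans (gG z _) _; first by near: z; exact: lt_nbhsr.
near: z; by have /cvgrPdist_lt /(_ e e0) := continuous_Gint t0.
Unshelve. all: by end_near. Qed.

Lemma continuous_Fint (t : R) : 0 < t -> {for t, continuous Fint}.
Proof.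
move=> t0; have [d _] := is_derive_Fint t0.
by apply/differentiable_continuous/derivable1_diffP.
Qed.

End Moments.

(** * The inverse of F and the free S transform *)

Section Inverse.
Variables (R : realType) (mu : probability R R).
Let vmax : R := 1 - fine (mu [set 0]).

Definition Tinv (v : R) : R := xget 0 [set t | 0 < t /\ Fint mu t = v].

Lemma TintK t : 0 < t -> Fint mu t < vmax -> Tinv (Fint mu t) = t.
Proof.
move=> t0 Ft; rewrite /Tinv; apply: xget_unique => // s [s0 st].
apply/eqP; rewrite eq_le !leNgt; apply/andP; split; apply/negP => h.
  by have := Fint_lt t0 h Ft; rewrite st ltxx.
by have := Fint_lt (mu := mu) s0 h; rewrite st => /(_ Ft); rewrite ltxx.
Qed.

Lemma TinvP v : 0 < v < vmax -> 0 < Tinv v /\ Fint mu (Tinv v) = v.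
Proof.
move=> /andP[v0 v1]; have [a a0 av] := Fint_small mu v0.
have [b b0 bv] := Fint_large v1.
have ab : a <= b.
  by rewrite leNgt; apply/negP => /ltW ba;
     have := Fint_le mu b0 ba; rewrite leNgt (lt_trans av bv).
have [||c cab cv] := @IVT _ (Fint mu) a b v ab.
- apply: continuous_in_subspaceT => t /set_mem /=; rewrite in_itv /= => /andP[at_ _].
  by apply: continuous_Fint; apply: lt_le_trans at_.
- by rewrite ge_min (ltW av) /= le_max (ltW bv) orbT.
have c0 : 0 < c by move: cab; rewrite in_itv /= => /andP[+ _]; apply: lt_le_trans.
by apply: (@xgetI _ 0 [set t | 0 < t /\ Fint mu t = v] c).
Qed.

Lemma is_derive_Tinv v : 0 < v < vmax ->
  is_derive v 1 Tinv (Gint mu (Tinv v))^-1.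
Proof.
move=> v01; have [T0 FT] := TinvP v01.
have /andP[v0 v1] := v01.
rewrite -[X in is_derive X _ _ _]FT; apply: (@is_derive_inverse _ (Fint mu)).
- near=> t; apply: TintK; first by near: t; exact: lt_nbhsr.
  by near: t; apply: (cvgr_lt _ (continuous_Fint T0)); rewrite FT.
- by near=> t; apply: continuous_Fint; near: t; exact: lt_nbhsr.
- exact: is_derive_Fint.
- by rewrite gt_eqF // Gint_gt0 // FT.
Unshelve. all: by end_near. Qed.

Lemma continuous_Tinv v : 0 < v < vmax -> {for v, continuous Tinv}.
Proof.
move=> /is_derive_Tinv[d _].
by apply/differentiable_continuous/derivable1_diffP.
Qed.

Hypothesis mu_neg : mu [set x : R | x < 0] = 0%E.

Lemma psiN t : 0 < t -> psi mu (- t) = - Fint mu t.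
Proof.
move=> t0; have it := integrable_phi mu t0.
rewrite /psi /Fint -[RHS]mulN1r -RintegralZl //.
congr fine; apply: ae_eq_integral => //.
(* The integrand of [psi] has a pole at -1/t. The pole lies in the null negative half-line, but
   measurability on the whole line still requires treating that point apart. *)
- apply/measurable_EFinP; pose x0 : R := - t^-1.
  have xt (x : R) : x != x0 -> 1 - - t * x != 0.
    rewrite mulNr opprK; apply: contra_neq => h.
    have : t^-1 * (1 + t * x) = 0 by rewrite h mulr0.
    by rewrite mulrDr mulr1 mulKf ?gt_eqF // => /eqP; rewrite addrC addr_eq0 => /eqP.
  rewrite -(setvU [set x0]); apply/measurable_funU => //; first exact: measurableC.
  split; last exact: measurable_fun_set1.
  apply: open_continuous_measurable_fun.
    by apply: closed_openC; apply: accessible_closed_set1; apply: hausdorff_accessible; exact: norm_hausdorff.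
  move=> x /set_mem /= /eqP /xt x1.
  apply: cvgM; first by apply: cvgMr; exact: cvg_id.
  apply: cvgV => //; apply: cvgB; first exact: cvg_cst.
  by apply: cvgMr; exact: cvg_id.
- have [] := integrableP _ _ _ (integrableZl measurableT (-1) it).
  by move=> h _; apply: eq_measurable_fun h => x _ /=; rewrite -EFinM.
exists [set x : R | x < 0]; split => //.
  by have := @measurable_itv R `]-oo, 0[; congr measurable; apply/seteqP; split => x /=; rewrite in_itv.
move=> x /= /not_implyP[_]; apply: contra_notP => /negP; rewrite -leNgt => x0.
by congr EFin; rewrite /phi ger0_norm // !mulNr opprK [t * x]mulrC mul1r.
Qed.

Lemma psi_invN v : 0 < v < vmax -> psi_inv mu (- v) = - Tinv v.
Proof.
move=> v01; have [T0 FT] := TinvP v01.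
rewrite /psi_inv; apply: xget_unique => /= [|w [w0 pw]].
  by rewrite oppr_lt0 psiN // FT.
have w0' : 0 < - w by rewrite oppr_gt0.
have Fw : Fint mu (- w) = v.
  by apply: oppr_inj; rewrite -psiN // opprK.
by rewrite -Fw TintK ?opprK // Fw; case/andP: v01.
Qed.

Lemma freeSN v : 0 < v < vmax -> freeS mu (- v) = (1 - v) / v * Tinv v.
Proof.
by move=> v01; rewrite /freeS psi_invN // invrN mulrN mulrN mulNr opprK.
Qed.

Lemma is_derive_freeSN v : 0 < v < vmax ->
  is_derive v 1 (fun w => freeS mu (- w))
    ((1 - v) / v / Gint mu (Tinv v) - Tinv v / v ^+ 2).
Proof.
move=> v01; have /andP[v0 v1] := v01.
have dT := is_derive_Tinv v01.
have vn : v != 0 by rewrite gt_eqF.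
have d1 : is_derive v 1 ((fun w : R => w^-1 - 1) * Tinv)
    ((1 - v) / v / Gint mu (Tinv v) - Tinv v / v ^+ 2).
  have dV : is_derive v 1 (fun w : R => w^-1) (- v ^- 2).
    split; first exact: derivableV.
    by rewrite deriveV // derive_id [LHS]mulr1.
  apply: is_derive_eq.
  have G0 : Gint mu (Tinv v) != 0.
    by have [T0 FT] := TinvP v01; rewrite gt_eqF // Gint_gt0 // FT.
  by rewrite /GRing.scale /=; field; rewrite vn G0.
apply: near_eq_is_derive d1.
near=> w; rewrite freeSN; last first.
  by apply/andP; split; near: w; [exact: lt_nbhsr|exact: lt_nbhsl].
have w0 : w != 0 by rewrite gt_eqF //; near: w; exact: lt_nbhsr.
by transitivity ((w^-1 - 1) * Tinv w) => //; field.
Unshelve. all: by end_near. Qed.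

End Inverse.

(** * Asymptotics of the coefficient ratios *)

Section RootMeans.
Variables (R : realType) (s : seq R).
Implicit Types t u : R.

Let m1_ge0 : 0 <= (size s)%:R^-1 :> R. Proof. by rewrite invr_ge0. Qed.

Let rcmB (f g : R -> R) :
  rcm_integral s f - rcm_integral s g = rcm_integral s (fun x => f x - g x).
Proof. by rewrite /rcm_integral -mulrBr sumrB. Qed.

Let rcmZ c (f : R -> R) : c * rcm_integral s f = rcm_integral s (fun x => c * f x).
Proof. by rewrite /rcm_integral mulrCA mulr_sumr. Qed.

Let le_rcm (f g : R -> R) : (forall x, f x <= g x) ->
  rcm_integral s f <= rcm_integral s g.
Proof. by move=> fg; rewrite /rcm_integral ler_wpM2l // ler_sum. Qed.

Lemma rcm_phiB_le t u : 0 < t -> t <= u ->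
  rcm_integral s (phi u) - rcm_integral s (phi t) <= (u - t) * rcm_integral s (gam t).
Proof. by move=> t0 tu; rewrite rcmB rcmZ; apply: le_rcm => x; apply: phiB_le. Qed.

Lemma rcm_phiB_ge t u : 0 < t -> t <= u ->
  (u - t) * rcm_integral s (gam u) <= rcm_integral s (phi u) - rcm_integral s (phi t).
Proof. by move=> t0 tu; rewrite rcmB rcmZ; apply: le_rcm => x; apply: phiB_ge. Qed.

Lemma rcm_gam_anti t u : 0 < t -> t <= u ->
  rcm_integral s (gam u) <= rcm_integral s (gam t).
Proof. by move=> t0 tu; apply: le_rcm => x; apply: gam_anti. Qed.

Lemma rcm_gam_ge0 t : 0 < t -> 0 <= rcm_integral s (gam t).
Proof. by move=> t0; rewrite mulr_ge0 // sumr_ge0 // => x _; apply: gam_ge0. Qed.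

(** Turns bounds on F_m(rho_k) into bounds on rho_k without inverting F_m. *)
Lemma rcm_phi_lt t u : 0 < u ->
  rcm_integral s (phi t) < rcm_integral s (phi u) -> t < u.
Proof.
move=> u0; rewrite !ltNge; apply: contra => ut.
rewrite -subr_ge0; apply: le_trans (rcm_phiB_ge u0 ut).
by rewrite mulr_ge0 ?subr_ge0 // rcm_gam_ge0 // (lt_le_trans u0).
Qed.

Lemma finSE (v : R) (k : nat) : (0 < k)%N -> Num.ceil ((size s)%:R * v) = k%:Z ->
  finS (poly_of_roots s) v =
    ((size s)%:R - k%:R + 1) / k%:R * sym_ratio s k.
Proof.
case: k => // k _ kE; rewrite /finS size_poly_of_roots kE /=.
rewrite /sym_ratio /esym (_ : k.+1%:Z - 1 = k%:Z) //; lia.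
Qed.

(** Adding 1/m to v raises the ceiling by exactly one, so this is the discrete product rule for the
    prefactor (m-k+1)/k times rho_k. *)
Lemma nablaE (v : R) (k : nat) : (0 < size s)%N -> (0 < k)%N ->
  Num.ceil ((size s)%:R * v) = k%:Z ->
  let h := (size s)%:R^-1 : R in let kap := k%:R / (size s)%:R : R in
  nabla (size s) (finS (poly_of_roots s)) v =
    (1 - kap) / (kap + h) * ((size s)%:R * (sym_ratio s k.+1 - sym_ratio s k))
    - sym_ratio s k * ((1 + h) / (kap * (kap + h))).
Proof.
move=> s0 k0 kE h kap.
have m0 : (size s)%:R != 0 :> R by rewrite pnatr_eq0 -lt0n.
have kn0 : k%:R != 0 :> R by rewrite pnatr_eq0 -lt0n.
have k1 : k%:R + 1 != 0 :> R by rewrite natr1 pnatr_eq0.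
rewrite /nabla (finSE k0 kE) (@finSE _ k.+1) //; last first.
  rewrite mulrDr mulfV // ceilDrz ?int_num1 // kE ceil1; lia.
rewrite /kap /h -natr1; field.
by rewrite m0 kn0 k1.
Qed.

Hypothesis s_ge0 : all (fun x => 0 <= x) s.

(** Bounds the proportion of positive roots from below by F_m(t), which weak convergence controls;
    this keeps e_k > 0 for the relevant k. *)
Lemma rcm_phi_le_npos t : 0 < t ->
  rcm_integral s (phi t) <= (npos s)%:R / (size s)%:R.
Proof.
move=> t0; rewrite /rcm_integral mulrC ler_wpM2r //.
rewrite /npos -sum1_count natr_sum [leRHS]big_mkcond /=.
rewrite [leLHS]big_seq [leRHS]big_seq; apply: ler_sum => x xs.
case: ifPn => [_|]; first exact: phi_le1.
rewrite -leNgt => x0; have -> : x = 0.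
  by apply/eqP; rewrite eq_le x0 (allP s_ge0).
by rewrite /phi normr0 !mul0r.
Qed.

Let rcm_phi t : rcm_integral s (phi t) =
  (\sum_(x <- s) (x * t / (1 + x * t))) / (size s)%:R.
Proof.
rewrite /rcm_integral mulrC; congr (_ / _); apply: eq_big_seq => x xs.
by rewrite /phi ger0_norm // (allP s_ge0).
Qed.

Lemma rcm_phi_sym_ratio_le k : (0 < k <= npos s)%N ->
  rcm_integral s (phi (sym_ratio s k)) <= k%:R / (size s)%:R.
Proof. by move=> kN; rewrite rcm_phi ler_wpM2r // sum_sym_ratio_le. Qed.

Lemma rcm_phi_sym_ratio_ge k : (k < npos s)%N ->
  k%:R / (size s)%:R <= rcm_integral s (phi (sym_ratio s k.+1)).
Proof. by move=> kN; rewrite rcm_phi ler_wpM2r // sum_sym_ratio_ge. Qed.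

Lemma sym_ratio_le k n : (0 < k)%N -> (k + n <= npos s)%N ->
  sym_ratio s k <= sym_ratio s (k + n).
Proof.
move=> k0; elim: n => [|n IH] kn; first by rewrite addn0.
apply: le_trans (IH _) _; first by lia.
by rewrite addnS -subr_ge0 ltW // sym_ratioB_gt0 //; lia.
Qed.

End RootMeans.

(** * Ratios and steps near a fixed v, uniformly in k *)

Section Local.
Variables (R : realType) (r : nat -> seq R) (mu : probability R R).
Hypothesis r_roots : forall m : nat, (0 < m)%N ->
  size (r m) = m /\ all (fun x => 0 <= x) (r m).
Hypothesis r_cvg : forall f : R -> R, continuous f ->
  (exists M : R, forall x, `|f x| <= M) ->
  (fun m => rcm_integral (r m) f) @ \oo --> fine (\int[mu]_x (f x)%:E)%E.

Let r_size m : (0 < m)%N -> size (r m) = m. Proof. by case/r_roots. Qed.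
Let r_ge0 m : (0 < m)%N -> all (fun x => 0 <= x) (r m). Proof. by case/r_roots. Qed.

Lemma cvg_rcm_phi t : 0 < t ->
  (fun m => rcm_integral (r m) (phi t)) @ \oo --> Fint mu t.
Proof.
move=> t0; apply: r_cvg; first exact: continuous_phi.
by exists 1 => x; rewrite ger0_norm ?phi_ge0 ?phi_le1.
Qed.

Lemma cvg_rcm_gam t : 0 < t ->
  (fun m => rcm_integral (r m) (gam t)) @ \oo --> Gint mu t.
Proof.
move=> t0; apply: r_cvg; first exact: continuous_gam.
by exists t^-1 => x; rewrite ger0_norm ?gam_ge0 ?gam_le.
Qed.

Variable v : R.
Hypothesis v_range : 0 < v < 1 - fine (mu [set 0]).
Let T := Tinv mu v.
Let G := Gint mu T.

Let T_gt0 : 0 < T. Proof. by case: (TinvP v_range). Qed.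
Let FT : Fint mu T = v. Proof. by case: (TinvP v_range). Qed.
Let G_gt0 : 0 < G.
Proof. by apply: Gint_gt0; rewrite // FT; case/andP: v_range. Qed.

Let near_inv_lt (e : R) : 0 < e -> \forall m \near \oo, m%:R^-1 < e.
Proof.
move=> e0; near=> m.
rewrite invf_plt ?posrE //; first by near: m; exact: nbhs_infty_gtr.
by rewrite ltr0n; near: m; exists 1%N.
Unshelve. all: by end_near. Qed.

Lemma sym_ratio_near (e : R) : 0 < e -> exists2 d : R, 0 < d &
  \forall m \near \oo, forall k, `|k%:R / m%:R - v| < d ->
    (0 < k < npos (r m))%N /\ `|sym_ratio (r m) k - T| < e.
Proof.
move=> e0.
have [c c0 /andP[cT ce]] : exists2 c : R, 0 < c & (c < T) && (c <= e).
  exists (Num.min (T / 2) e); first by rewrite lt_min e0 divr_gt0.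
  by rewrite gt_min ge_min lexx orbT andbT ltr_pdivrMr // ltr_pMr // ltr1n.
have l0 : 0 < T - c by rewrite subr_gt0.
have u0 : 0 < T + c by rewrite addr_gt0.
have Fl : Fint mu (T - c) < v.
  have := FintB_ge mu l0 (_ : T - c <= T); rewrite FT opprB addrCA subrr addr0.
  rewrite gerBl ltW // => /(_ isT) h.
  by rewrite -subr_gt0; apply: lt_le_trans h; rewrite mulr_gt0.
have Fu : v < Fint mu (T + c).
  by rewrite -FT; apply: Fint_lt => //; [rewrite ltrDl|rewrite FT; case/andP: v_range].
have Fl0 : 0 <= Fint mu (T - c) by apply: Rintegral_ge0 => x _; apply: phi_ge0.
(* One third each for the distance of k/m from v, for F_m - F at T - c and T + c, and for the shift
   1/m in (k-1)/m <= F_m(rho_k). *)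
pose d := Num.min (v - Fint mu (T - c)) (Fint mu (T + c) - v) / 3.
have d0 : 0 < d by rewrite divr_gt0 // lt_min !subr_gt0 Fl Fu.
have dl : 3 * d <= v - Fint mu (T - c) by rewrite /d mulrC divfK // ge_min lexx.
have du : 3 * d <= Fint mu (T + c) - v by rewrite /d mulrC divfK // ge_min lexx orbT.
exists d => //; near=> m => k; rewrite ltr_distl => /andP[kl ku].
have m0 : (0 < m)%N by near: m; exists 1%N.
have sm := r_size m0; have rm := r_ge0 m0.
have md : m%:R^-1 < d by near: m; exact: near_inv_lt.
have ml : rcm_integral (r m) (phi (T - c)) < Fint mu (T - c) + d.
  by near: m; apply: (cvgr_lt _ (cvg_rcm_phi l0)); rewrite ltrDl.
have mu' : Fint mu (T + c) - d < rcm_integral (r m) (phi (T + c)).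
  by near: m; apply: (cvgr_gt _ (cvg_rcm_phi u0)); rewrite ltrBlDr ltrDl.
have m0' : 0 < m%:R :> R by rewrite ltr0n.
have kN : (k < npos (r m))%N.
  rewrite -(ltr_nat R) -(ltr_pM2r (x := m%:R^-1)) ?invr_gt0 //.
  have := rcm_phi_le_npos rm u0; rewrite sm; lra.
have k0 : (0 < k)%N.
  by rewrite lt0n; apply/eqP => k0; move: kl; rewrite k0 mul0r; lra.
split; first by rewrite k0.
have rk : 0 < sym_ratio (r m) k by apply: sym_ratio_gt0; rewrite // k0 ltnW.
rewrite ltr_distl; apply/andP; split.
  apply: le_lt_trans (_ : T - c < _); first by rewrite lerD2l lerN2.
  apply: (@rcm_phi_lt _ (r m)) => //.
  case: k k0 kN kl ku rk => // k _ kN kl ku rk.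
  have := rcm_phi_sym_ratio_ge rm (ltnW kN); rewrite sm.
  apply: lt_le_trans; apply: lt_trans ml _.
  move: kl; rewrite -natr1 mulrDl mul1r; lra.
apply: lt_le_trans (_ : T + c <= _); last by rewrite lerD2l.
apply: (@rcm_phi_lt _ (r m)) => //.
have := @rcm_phi_sym_ratio_le _ (r m) rm k; rewrite k0 ltnW // sm => /(_ isT) h.
by apply: le_lt_trans h _; lra.
Unshelve. all: by end_near. Qed.

(** F_m grows by between (n-1)/m and (n+1)/m from rho_k to rho_(k+n), and its slope there lies
    between its slopes at T + c and T - c, which are close to G. *)
Lemma sym_ratio_increment_near (e : R) : 0 < e < 1 -> exists2 d : R, 0 < d &
  \forall m \near \oo, forall k n, `|k%:R / m%:R - v| < d ->
    `|(k + n)%:R / m%:R - v| < d ->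
    (1 - e) * (n%:R - 1)
      <= G * (m%:R * (sym_ratio (r m) (k + n) - sym_ratio (r m) k))
      <= (1 + e) * (n%:R + 1).
Proof.
move=> /andP[e0 e1].
have Gu : G < G / (1 - e) by rewrite ltr_pdivlMr ?subr_gt0 // gtr_pMr //; lra.
have Gl : G / (1 + e) < G by rewrite ltr_pdivrMr ?addr_gt0 // ltr_pMr //; lra.
have [c c0 [cT [Gcu Gcl]]] : exists2 c : R, 0 < c &
    c < T /\ Gint mu (T - c) < G / (1 - e) /\ G / (1 + e) < Gint mu (T + c).
  have : \forall t \near T, Gint mu t < G / (1 - e) /\ G / (1 + e) < Gint mu t.
    near=> t; split; near: t.
      exact: (cvgr_lt _ (continuous_Gint T_gt0)).
    exact: (cvgr_gt _ (continuous_Gint T_gt0)).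
  move=> /nbhs_ballP[c /= c0 hc].
  exists (Num.min (c / 2) (T / 2)); first by rewrite lt_min !divr_gt0.
  set b := Num.min _ _.
  have b0 : 0 < b by rewrite lt_min !divr_gt0.
  have bc : b < c.
    by rewrite gt_min ltr_pdivrMr // ltr_pMr // ltr1n.
  split; first by rewrite gt_min orbC ltr_pdivrMr // ltr_pMr // ltr1n.
  split.
    by apply: (proj1 (hc _ _)); rewrite /ball /= opprB addrCA subrr addr0 gtr0_norm.
  by apply: (proj2 (hc _ _)); rewrite /ball /= opprD addrA subrr sub0r normrN gtr0_norm.
have l0 : 0 < T - c by rewrite subr_gt0.
have u0 : 0 < T + c by rewrite addr_gt0.
have [d d0 hd] := sym_ratio_near c0.
exists d => //; near=> m => k n kd knd.
have m0 : (0 < m)%N by near: m; exists 1%N.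
have sm := r_size m0; have rm := r_ge0 m0.
have m0' : 0 < m%:R :> R by rewrite ltr0n.
have hm : forall k, `|k%:R / m%:R - v| < d ->
    (0 < k < npos (r m))%N /\ `|sym_ratio (r m) k - T| < c by near: m.
have [/andP[k0 kN]] := hm _ kd; rewrite ltr_distl => /andP[kl ku].
have [/andP[_ knN]] := hm _ knd; rewrite ltr_distl => /andP[knl knu].
have gu : rcm_integral (r m) (gam (T - c)) < G / (1 - e).
  by near: m; apply: (cvgr_lt _ (cvg_rcm_gam l0)).
have gl : G / (1 + e) < rcm_integral (r m) (gam (T + c)).
  by near: m; apply: (cvgr_gt _ (cvg_rcm_gam u0)).
have ts : sym_ratio (r m) k <= sym_ratio (r m) (k + n).
  by apply: sym_ratio_le => //; apply: ltnW.
have k1N : (k.-1 < npos (r m))%N by apply: leq_ltn_trans kN; exact: leq_pred.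
have kn1N : ((k + n).-1 < npos (r m))%N by apply: leq_ltn_trans knN; exact: leq_pred.
have a1 := rcm_phi_sym_ratio_ge rm k1N.
have a2 := rcm_phi_sym_ratio_ge rm kn1N.
have a3 : rcm_integral (r m) (phi (sym_ratio (r m) k)) <= k%:R / m%:R.
  by rewrite -[in X in _ / X]sm; apply: rcm_phi_sym_ratio_le; rewrite // k0 ltnW.
have a4 : rcm_integral (r m) (phi (sym_ratio (r m) (k + n))) <= (k + n)%:R / m%:R.
  by rewrite -[in X in _ / X]sm; apply: rcm_phi_sym_ratio_le; rewrite // addn_gt0 k0 /= ltnW.
rewrite sm prednK // in a1; rewrite sm prednK ?addn_gt0 ?k0 // in a2.
have E1 : k.-1%:R = k%:R - 1 :> R by rewrite -[in RHS](prednK k0) -natr1 addrK.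
have E2 : (k + n).-1%:R = k%:R + n%:R - 1 :> R.
  by rewrite -natrD -[in RHS](prednK (_ : 0 < k + n)%N) ?addn_gt0 ?k0 // -natr1 addrK.
rewrite E1 in a1; rewrite E2 in a2; rewrite natrD in a4.
move: kl knu a1 a2 a3 a4 ts; set t := sym_ratio _ k; set u := sym_ratio _ (k + n).
move=> kl knu a1 a2 a3 a4 tu.
have t0 : 0 < t by apply: lt_trans kl.
have b1 := rcm_phiB_ge (r m) t0 tu.
have b2 := rcm_phiB_le (r m) t0 tu.
have g1 : rcm_integral (r m) (gam (T + c)) <= rcm_integral (r m) (gam u).
  by apply: rcm_gam_anti; [apply: lt_le_trans tu|apply: ltW].
have g2 : rcm_integral (r m) (gam t) <= rcm_integral (r m) (gam (T - c)).
  by apply: rcm_gam_anti => //; apply: ltW.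
have ut0 : 0 <= m%:R * (u - t) by rewrite mulr_ge0 ?subr_ge0 // ltW.
have {}b1 : m%:R * (u - t) * (G / (1 + e)) <= n%:R + 1.
  apply: le_trans (ler_wpM2l ut0 (le_trans (ltW gl) g1)) _.
  rewrite -mulrA; apply: le_trans (ler_wpM2l (ltW m0') b1) _.
  rewrite mulrC -ler_pdivlMr //; apply: le_trans (lerB a4 a1) _.
  by rewrite -mulrBl ler_wpM2r ?invr_ge0 ?(ltW m0') //; lra.
have {}b2 : n%:R - 1 <= m%:R * (u - t) * (G / (1 - e)).
  apply: le_trans (ler_wpM2l ut0 (le_trans g2 (ltW gu))).
  rewrite -mulrA; apply: le_trans (ler_wpM2l (ltW m0') b2).
  rewrite mulrC -ler_pdivrMr //; apply: le_trans (lerB a2 a3).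
  by rewrite -mulrBl ler_wpM2r ?invr_ge0 ?(ltW m0') //; lra.
rewrite mulrA ler_pdivrMr ?addr_gt0 // in b1.
rewrite mulrA ler_pdivlMr ?subr_gt0 // in b2.
by rewrite mulrC [G * _]mulrC b2 [_ * (_ + 1)]mulrC b1.
Unshelve. all: by end_near. Qed.

Lemma sym_ratio_step_near (e : R) : 0 < e -> exists2 d : R, 0 < d &
  \forall m \near \oo, forall k, `|k%:R / m%:R - v| < d ->
    `|G * (m%:R * (sym_ratio (r m) k.+1 - sym_ratio (r m) k)) - 1| <= e.
Proof.
move=> e0; have [p [L [eta /andP[eta0 eta1] [pL bal]]]] := balanced_center e0.
have [|d1 d10 inc] := @sym_ratio_increment_near eta; first by rewrite eta0; lra.
(* Ratios within a factor 1 - eta/4 to 1 + eta/4 of T give rho_(k+3) <= (1 + eta) rho_(k+1), as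
   [balanced] demands. *)
have Te : 0 < T * (eta / 4) by rewrite mulr_gt0 // divr_gt0.
have [d2 d20 rat] := sym_ratio_near Te.
have v0 : 0 < v by case/andP: v_range.
(* One d is for k/m and another for the width of the window over m; 2 d <= v leaves room for p
   indices below k. *)
have [d d0 [dd1 dd2 dv]] : exists2 d : R, 0 < d & [/\ 2 * d <= d1, 2 * d <= d2 & 2 * d <= v].
  exists (Num.min d1 (Num.min d2 v) / 2).
    by rewrite divr_gt0 // !lt_min d10 d20.
  by split; rewrite mulrC divfK // !ge_min lexx ?orbT.
exists d => //; near=> m => k kd.
have m0 : (0 < m)%N by near: m; exists 1%N.
have sm := r_size m0; have rm := r_ge0 m0.
have m0' : 0 < m%:R :> R by rewrite ltr0n.
have Lm : (p + L + 4)%:R / m%:R < d.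
  rewrite mulrC -ltr_pdivlMr ?ltr0n ?addn_gt0 ?orbT //.
  by near: m; apply: near_inv_lt; rewrite divr_gt0 // ltr0n addn_gt0 orbT.
have inc' : forall k n, `|k%:R / m%:R - v| < d1 ->
    `|(k + n)%:R / m%:R - v| < d1 ->
    (1 - eta) * (n%:R - 1)
      <= G * (m%:R * (sym_ratio (r m) (k + n) - sym_ratio (r m) k))
      <= (1 + eta) * (n%:R + 1) by near: m.
have rat' : forall k, `|k%:R / m%:R - v| < d2 ->
    (0 < k < npos (r m))%N /\ `|sym_ratio (r m) k - T| < T * (eta / 4) by near: m.
have pk : (p <= k)%N.
  rewrite leqNgt; apply/negP => kp.
  have : k%:R / m%:R <= (p + L + 4)%:R / m%:R :> R.
    by rewrite ler_wpM2r ?invr_ge0 // ler_nat; clear -kp; lia.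
  by move: kd; rewrite ltr_distl => /andP[? _] ?; lra.
pose q := (k - p)%N.
have win i : (i <= L + 3)%N -> `|(q + i)%:R / m%:R - v| < 2 * d.
  move=> iL; move: kd; rewrite !ltr_distl => /andP[kl ku].
  have h1 : (q + i)%:R / m%:R <= k%:R / m%:R + (p + L + 4)%:R / m%:R :> R.
    rewrite -mulrDl -natrD ler_wpM2r ?invr_ge0 // ler_nat /q.
    by clear -iL pk; lia.
  have h2 : k%:R / m%:R <= (q + i)%:R / m%:R + (p + L + 4)%:R / m%:R :> R.
    rewrite -mulrDl -natrD ler_wpM2r ?invr_ge0 // ler_nat /q.
    by clear -iL pk; lia.
  by apply/andP; split; lra.
have win1 i (iL : (i <= L + 3)%N) := lt_le_trans (win i iL) dd1.
have win2 i (iL : (i <= L + 3)%N) := rat' _ (lt_le_trans (win i iL) dd2).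
pose D j := G * (m%:R * (sym_ratio (r m) (q + j).+1 - sym_ratio (r m) (q + j))).
have -> : G * (m%:R * (sym_ratio (r m) k.+1 - sym_ratio (r m) k)) = D p.
  by rewrite /D /q subnK.
apply: bal; split.
- move=> j jL; rewrite /D !mulr_gt0 //; apply: sym_ratioB_gt0 => //.
  by case: (win2 j) => //; clear -jL; lia.
- move=> j jL; have [|/andP[j0 jN] _] := win2 j; first by clear -jL; lia.
  have [|/andP[_ j1N]] := win2 j.+1; first by clear -jL; lia.
  have [|/andP[_ j3N]] := win2 j.+3; first by clear -jL; lia.
  rewrite !ltr_distl => /andP[_ r3] /andP[r1 _].
  have := sym_ratioB_logconcave rm j0 (_ : (q + j).+3 <= _)%N.
  rewrite /D !addnS in r1 r3 j3N *; rewrite (ltnW j3N) => /(_ isT).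
  move: r1 r3.
  set x1 := sym_ratio _ (q + j).+1; set x3 := sym_ratio _ (q + j).+3.
  set x0 := sym_ratio _ (q + j); set x2 := sym_ratio _ (q + j).+2.
  move=> r1 r3 lc.
  have x1p : 0 < x1 by apply: lt_trans r1; have : T * (eta / 4) < T * 1; [rewrite ltr_pM2l //|]; lra.
  have x31 : x3 <= (1 + eta) * x1.
    have : (1 + eta) * (T - T * (eta / 4)) <= (1 + eta) * x1.
      by rewrite ler_wpM2l ?ltW // addr_gt0.
    apply: le_trans; apply: le_trans (ltW r3) _.
    have : T * (eta * eta) <= T * (eta / 2).
      by rewrite ler_wpM2l ?(ltW T_gt0) // ler_wpM2l ?(ltW eta0).
    by have := mulr_gt0 T_gt0 eta0; lra.
  have lc' : (x1 - x0) * (x3 - x2) <= (1 + eta) * (x2 - x1) ^+ 2.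
    rewrite -(ler_pM2l x1p); apply: le_trans lc _.
    by rewrite [leRHS]mulrA [x1 * (1 + _)]mulrC ler_wpM2r ?sqr_ge0.
  have -> : G * (m%:R * (x1 - x0)) * (G * (m%:R * (x3 - x2)))
      = (G * m%:R) ^+ 2 * ((x1 - x0) * (x3 - x2)) by ring.
  have -> : (1 + eta) * (G * (m%:R * (x2 - x1))) ^+ 2
      = (G * m%:R) ^+ 2 * ((1 + eta) * (x2 - x1) ^+ 2) by ring.
  by rewrite ler_wpM2l ?sqr_ge0.
- move=> i n iL n0.
  have -> : \sum_(l < n) D (i + l)%N =
      G * (m%:R * (sym_ratio (r m) (q + i + n) - sym_ratio (r m) (q + i))).
    rewrite -!mulr_sumr; congr (_ * (_ * _)).
    elim: n {iL n0} => [|n IH]; first by rewrite big_ord0 addn0 subrr.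
    by rewrite big_ord_recr /= IH !addnA addnS addrC addrA subrK.
  apply: inc'; first by apply: win1; clear -iL; lia.
  by rewrite -addnA; apply: win1; clear -iL; lia.
Unshelve. all: by end_near. Qed.

End Local.

(** * Joint limits in the point and the degree *)

Section JointLimit.
Variables (R : realType) (r : nat -> seq R) (mu : probability R R).
Hypothesis r_roots : forall m : nat, (0 < m)%N ->
  size (r m) = m /\ all (fun x => 0 <= x) (r m).
Hypothesis r_cvg : forall f : R -> R, continuous f ->
  (exists M : R, forall x, `|f x| <= M) ->
  (fun m => rcm_integral (r m) f) @ \oo --> fine (\int[mu]_x (f x)%:E)%E.
Hypothesis mu_neg : mu [set x : R | x < 0] = 0%E.
Variable v : R.
Hypothesis v_range : 0 < v < 1 - fine (mu [set 0]).
Let T := Tinv mu v.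
Let G := Gint mu T.

Let v_gt0 : 0 < v. Proof. by case/andP: v_range. Qed.
Let G_gt0 : 0 < G.
Proof.
have [T0 FT] := TinvP v_range.
by apply: Gint_gt0; rewrite // FT; case/andP: v_range.
Qed.

Let Fl : set_system (R * nat) := filter_prod (nbhs v) \oo.
Let kk (p : R * nat) : nat := `|Num.ceil (p.2%:R * p.1)|%N.
Let kap (p : R * nat) : R := (kk p)%:R / p.2%:R.
Let h (p : R * nat) : R := p.2%:R^-1.

Let near2 (P : nat -> Prop) : (\forall m \near \oo, P m) -> \forall p \near Fl, P p.2.
Proof.
by move=> HP; exists (setT, P) => [|p []//]; split => //=; exact: filterT.
Qed.

Let near1 (P : R -> Prop) : (\forall w \near v, P w) -> \forall p \near Fl, P p.1.
Proof.
by move=> HP; exists (P, setT) => [|p []//]; split => //=; exact: filterT.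
Qed.

Let cvg1 : fst @ Fl --> v.
Proof. by move=> A vA; apply: near1. Qed.

Let near_kk : \forall p \near Fl, [/\ (0 < p.2)%N, (0 < kk p)%N &
  Num.ceil (p.2%:R * p.1) = (kk p)%:Z].
Proof.
near=> p; have p0 : (0 < p.2)%N by near: p; apply: (near2 (P := fun m => (0 < m)%N)); exists 1%N.
have w0 : 0 < p.1 by near: p; apply: (near1 (P := fun w => 0 < w)); exact: lt_nbhsr.
have c0 : 0 < Num.ceil (p.2%:R * p.1).
  by rewrite ceil_gt0 mulr_gt0 // ltr0n.
by split=> //; rewrite /kk; lia.
Unshelve. all: by end_near. Qed.

Let cvg_h : h @ Fl --> (0 : R).
Proof.
apply/cvgrPdist_lt => e e0; near=> p.
rewrite sub0r normrN ger0_norm ?invr_ge0 //; near: p.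
apply: (near2 (P := fun m => m%:R^-1 < e)); near=> m.
rewrite invf_plt ?posrE //; first by near: m; exact: nbhs_infty_gtr.
by rewrite ltr0n; near: m; exists 1%N.
Unshelve. all: by end_near. Qed.

Let cvg_kap : kap @ Fl --> v.
Proof.
have kap_near : \forall p \near Fl, p.1 <= kap p <= p.1 + h p.
  near=> p.
  have [p0 k0 kE] : [/\ (0 < p.2)%N, (0 < kk p)%N &
     Num.ceil (p.2%:R * p.1) = (kk p)%:Z] by near: p.
  have pp : 0 < p.2%:R :> R by rewrite ltr0n.
  have := ceil_itv (p.2%:R * p.1); rewrite kE /kap /h => /andP[h1 h2].
  rewrite ler_pdivlMr // mulrC h2 ler_pdivrMr // mulrDl mulVf ?gt_eqF //.
  by rewrite [p.1 * _]mulrC -lerBlDr ltW //; move: h1; rewrite intrB.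
apply: (@squeeze_cvgr _ _ _ _ fst (fun p => p.1 + h p)).
- exact: kap_near.
- exact: cvg1.
- by rewrite -[X in _ --> X]addr0; apply: cvgD cvg_h; exact: cvg1.
Unshelve. all: by end_near. Qed.

Let cvg_ratio : (fun p => sym_ratio (r p.2) (kk p)) @ Fl --> T.
Proof.
apply/cvgrPdist_lt => e e0.
have [d d0 hd] := sym_ratio_near r_roots r_cvg v_range e0.
near=> p; rewrite distrC.
have hp : forall k, `|k%:R / p.2%:R - v| < d ->
    (0 < k < npos (r p.2))%N /\ `|sym_ratio (r p.2) k - T| < e.
  by near: p; exact: (near2 hd).
apply: (proj2 (hp _ _)); rewrite distrC; near: p.
by have /cvgrPdist_lt := cvg_kap; apply.
Unshelve. all: by end_near. Qed.

Let cvg_step : (fun p => p.2%:R * (sym_ratio (r p.2) (kk p).+1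
  - sym_ratio (r p.2) (kk p))) @ Fl --> G^-1.
Proof.
apply/cvgrPdist_le => e e0.
have [|d d0 hd] := @sym_ratio_step_near _ _ _ r_roots r_cvg _ v_range (e * G).
  by rewrite mulr_gt0.
near=> p; rewrite distrC.
have hp : forall k, `|k%:R / p.2%:R - v| < d ->
    `|G * (p.2%:R * (sym_ratio (r p.2) k.+1 - sym_ratio (r p.2) k)) - 1| <= e * G.
  by near: p; exact: (near2 hd).
have hk : `|kap p - v| < d.
  by rewrite distrC; near: p; have /cvgrPdist_lt := cvg_kap; apply.
have := hp _ hk; set x := _ * (_ - _).
have -> : G * x - 1 = G * (x - G^-1) by rewrite mulrBr mulfV // gt_eqF.
by rewrite normrM gtr0_norm // [e * G]mulrC ler_pM2l.
Unshelve. all: by end_near. Qed.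

Let L := (1 - v) / v / G - T / v ^+ 2.

Lemma cvg_nabla_finS :
  (fun p => nabla p.2 (finS (poly_of_roots (r p.2))) p.1) @ filter_prod (nbhs v) \oo --> L.
Proof.
have v0 : v != 0 by rewrite gt_eqF.
have kh : (fun p => kap p + h p) @ Fl --> v.
  by rewrite -[X in _ --> X]addr0; apply: cvgD.
pose X p := (1 - kap p) / (kap p + h p) * (p.2%:R * (sym_ratio (r p.2) (kk p).+1
  - sym_ratio (r p.2) (kk p)))
  - sym_ratio (r p.2) (kk p) * ((1 + h p) / (kap p * (kap p + h p))).
have cX : X @ Fl --> L.
  have -> : L = (1 - v) / v * G^-1 - T * ((1 + 0) / (v * v)).
    by rewrite /L addr0 expr2 mul1r.
  apply: cvgB; apply: cvgM => //.
    apply: cvgM; first by apply: cvgB => //; exact: cvg_cst.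
    exact: cvgV.
  apply: cvgM; first by apply: cvgD => //; exact: cvg_cst.
  by apply: cvgV; [rewrite mulf_neq0|apply: cvgM].
apply: cvg_trans cX; apply: near_eq_cvg; near=> p.
have [p0 k0 kE] : [/\ (0 < p.2)%N, (0 < kk p)%N &
     Num.ceil (p.2%:R * p.1) = (kk p)%:Z] by near: p.
have [sm rm] := r_roots p0.
have := @nablaE _ (r p.2) p.1 (kk p); rewrite !sm => /(_ p0 k0 kE) ->.
by [].
Unshelve. all: by end_near. Qed.

(** Continuity of the limit derivative, put in joint form so that it can be subtracted from the
    discrete derivative near (v, oo). *)
Lemma cvg_derive1_freeS :
  (fun p : R * nat => derive1 (fun w => freeS mu (- w)) p.1) @ filter_prod (nbhs v) \oo --> L.
Proof.
apply: (@cvg_comp _ _ _ fst (derive1 (fun w => freeS mu (- w))) _ (nbhs v)).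
  exact: cvg1.
pose g w : R := (1 - w) / w / Gint mu (Tinv mu w) - Tinv mu w / w ^+ 2.
have v0 : v != 0 by rewrite gt_eqF.
have T0 : 0 < T by case: (TinvP v_range).
have cT : Tinv mu @ v --> T by exact: continuous_Tinv.
have cg : g @ v --> L.
  apply: cvgB; apply: cvgM => //.
  - apply: cvgM; first by apply: cvgB; [exact: cvg_cst|exact: cvg_id].
    by apply: cvgV => //; exact: cvg_id.
  - apply: cvgV; first by rewrite gt_eqF.
    exact: (cvg_comp _ _ cT (continuous_Gint T0)).
  - apply: cvgV; first by rewrite expf_neq0.
    by apply: cvgM; exact: cvg_id.
apply: cvg_trans cg; apply: near_eq_cvg; near=> w.
have w01 : 0 < w < 1 - fine (mu [set 0]).
  by apply/andP; split; near: w; [exact: lt_nbhsr|apply: lt_nbhsl; case/andP: v_range].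
have d := is_derive_freeSN mu_neg w01.
by rewrite derive1E derive_val.
Unshelve. all: by end_near. Qed.

End JointLimit.

Theorem mainTheorem10 (R : realType) (r : nat -> seq R) (mu : probability R R) :
  (forall m : nat, (0 < m)%N -> size (r m) = m /\ all (fun x => 0 <= x) (r m)) ->
  mu [set x : R | x < 0] = 0%E ->
  ~ (forall A : set R, measurable A -> mu A = \d_(0 : R) A) ->
  (forall f : R -> R, continuous f -> (exists M : R, forall x, `|f x| <= M) ->
     (fun m => rcm_integral (r m) f) @ \oo
       --> fine (\int[mu]_x (f x)%:E)%E) ->
  (forall v : R, 0 < v < 1 - fine (mu [set 0]) ->
     derivable (fun w => freeS mu (- w)) v 1) /\
  (forall a b : R, 0 < a -> b < 1 - fine (mu [set 0]) ->
     forall eps : R, 0 < eps ->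
       \forall m \near \oo, forall v : R, a <= v <= b ->
         `| nabla m (finS (poly_of_roots (r m))) v
            - derive1 (fun w => freeS mu (- w)) v | < eps).
Proof.
move=> r_roots mu_neg _ r_cvg; split.
  by move=> v v01; have [] := is_derive_freeSN mu_neg v01.
move=> a b a0 b1 eps eps0.
(* At each x in [a, b] the difference tends to 0 jointly as v -> x and m -> oo; the covering form of
   compactness then gives one threshold for m on the whole segment. *)
have := @segment_compact _ a b; rewrite compact_near_coveringP.
move=> /(_ nat \oo (fun m v => `| nabla m (finS (poly_of_roots (r m))) v
            - derive1 (fun w => freeS mu (- w)) v | < eps) _) cov.
near=> m => v vab.
have : `[a, b] `<=` fun v => `| nabla m (finS (poly_of_roots (r m))) v
            - derive1 (fun w => freeS mu (- w)) v | < eps.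
  near: m; apply: cov => x /=; rewrite in_itv /= => /andP[ax xb].
  have x01 : 0 < x < 1 - fine (mu [set 0]).
    by rewrite (lt_le_trans a0 ax) (le_lt_trans xb b1).
  have c1 := cvg_nabla_finS r_roots r_cvg x01.
  have c2 := cvg_derive1_freeS mu_neg x01.
  have c0 : (fun p => nabla p.2 (finS (poly_of_roots (r p.2))) p.1
      - derive1 (fun w => freeS mu (- w)) p.1) @ filter_prod (nbhs x) \oo --> (0 : R).
    by have := cvgB c1 c2; rewrite subrr; apply; exact: filter_prod_filter.
  have /cvgrPdist_lt /(_ eps eps0) := c0.
  by apply: filterS => p /=; rewrite sub0r normrN.
by apply; rewrite /= in_itv.
Unshelve. all: by end_near. Qed.
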